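(* For $n\ge 1$ let $\mathcal{G}_n$ be the arrangement of hyperplanes in $V_{n-1}=\{(x_1,\dots,x_n)\in\mathbb{R}^n : x_1+\cdots+x_n=0\}$ given by $$x_i-x_j=a_i,\qquad 1\le i\le n,\ 1\le j\le n,\ i\ne j,$$ where $a_1,a_2,\dots$ are generic real numbers (e.g. linearly independent over $\mathbb{Q}$). Let $r(\mathcal{G}_n)$ be its number of regions, with the convention $r(\mathcal{G}_0)=1$, and let $$z=\sum_{n\ge 0} r(\mathcal{G}_n)\frac{x^n}{n!}=1+x+3\frac{x^2}{2!}+19\frac{x^3}{3!}+195\frac{x^4}{4!}+2831\frac{x^5}{5!}+53703\frac{x^6}{6!}+\cdots.$$ Define the power series $y=1+x+5\frac{x^2}{2!}+46\frac{x^3}{3!}+631\frac{x^4}{4!}+11586\frac{x^5}{5!}+\cdots$ by the equation $1=y\,(2-e^{xy})$. Then $z$ is the unique power series satisfying $z'/z=y^2$ and $z(0)=1$.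
   Context: A region of a finite arrangement of affine hyperplanes in a real vector space is a connected component of the complement of the union of the hyperplanes. All power series are formal power series in $x$. *)

(* Defs.v *)
From HB Require Import structures.
From mathcomp Require Import all_boot all_order all_algebra.
From mathcomp Require Import finmap.
From mathcomp Require Import all_classical all_reals all_analysis.
Import Order.TTheory GRing.Theory Num.Theory.
Import numFieldNormedType.Exports.

Set Implicit Arguments.
Unset Strict Implicit.
Unset Printing Implicit Defensive.

Local Open Scope classical_set_scope.
Local Open Scope ring_scope.

(** * Formal power series *)

(* A record rather than the bare type [nat -> K], which already carries the
   pointwise ring structure. *)
Record fps (K : fieldType) := FPS { fps_coef : nat -> K }.

Arguments FPS {K} fps_coef.

HB.instance Definition _ (K : fieldType) := gen_eqMixin (fps K).
HB.instance Definition _ (K : fieldType) := gen_choiceMixin (fps K).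

Section Fps.
Variable K : fieldType.
Implicit Types f g h : fps K.

Lemma fpsP f g : (forall n, fps_coef f n = fps_coef g n) -> f = g.
Proof. by case: f => f; case: g => g /= fg; congr FPS; apply/funext. Qed.

Definition fps_zero : fps K := FPS (fun=> 0).
Definition fps_opp f : fps K := FPS (fun n => - fps_coef f n).
Definition fps_add f g : fps K := FPS (fun n => fps_coef f n + fps_coef g n).
Definition fps_one : fps K := FPS (fun n => (n == 0%N)%:R).
Definition fps_mul f g : fps K :=
  FPS (fun n => \sum_(i < n.+1) fps_coef f i * fps_coef g (n - i)%N).

Fact fps_addA : associative fps_add.
Proof. by move=> f g h; apply: fpsP => n /=; rewrite addrA. Qed.
Fact fps_addC : commutative fps_add.
Proof. by move=> f g; apply: fpsP => n /=; rewrite addrC. Qed.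
Fact fps_add0 : left_id fps_zero fps_add.
Proof. by move=> f; apply: fpsP => n /=; rewrite add0r. Qed.
Fact fps_addN : left_inverse fps_zero fps_opp fps_add.
Proof. by move=> f; apply: fpsP => n /=; rewrite addNr. Qed.

HB.instance Definition _ :=
  GRing.isZmodule.Build (fps K) fps_addA fps_addC fps_add0 fps_addN.

Let T N f : {poly K} := \poly_(i < N) fps_coef f i.

Let fps_mul_poly N n f g : (n < N)%N ->
  fps_coef (fps_mul f g) n = (T N f * T N g)`_n.
Proof.
move=> nN; rewrite coefM /=; apply: eq_bigr => i _; rewrite !coef_poly.
have -> : (i < N)%N by apply: leq_trans nN; rewrite ltn_ord.
by have -> : (n - i < N)%N by apply: leq_ltn_trans nN; rewrite leq_subr.
Qed.

Fact fps_mulA : associative fps_mul.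
Proof.
move=> f g h; apply: fpsP => n.
have -> : fps_coef (fps_mul f (fps_mul g h)) n
          = (T n.+1 f * (T n.+1 g * T n.+1 h))`_n.
  rewrite coefM /=; apply: eq_bigr => i _.
  by rewrite coef_poly ltn_ord -(@fps_mul_poly n.+1) // ltnS leq_subr.
rewrite mulrA coefM /=; apply: eq_bigr => i _.
by rewrite coef_poly ltnS leq_subr -(@fps_mul_poly n.+1).
Qed.

Fact fps_mulC : commutative fps_mul.
Proof.
by move=> f g; apply: fpsP => n; rewrite !(@fps_mul_poly n.+1) // mulrC.
Qed.

Fact fps_mul1 : left_id fps_one fps_mul.
Proof.
move=> f; apply: fpsP => n /=.
rewrite big_ord_recl /= mul1r subn0 big1 ?addr0 // => i _.
by rewrite /= mul0r.
Qed.

Fact fps_mulDl : left_distributive fps_mul fps_add.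
Proof.
move=> f g h; apply: fpsP => n /=; rewrite -big_split /=.
by apply: eq_bigr => i _; rewrite mulrDl.
Qed.

Fact fps_one_neq0 : fps_one != 0.
Proof.
by apply/eqP => /(congr1 (fun f => fps_coef f 0)) /eqP /=; rewrite oner_eq0.
Qed.

HB.instance Definition _ := GRing.Zmodule_isComNzRing.Build (fps K)
  fps_mulA fps_mulC fps_mul1 fps_mulDl fps_one_neq0.

Lemma fps_coef0 n : fps_coef (0 : fps K) n = 0. Proof. by []. Qed.
Lemma fps_coef1 n : fps_coef (1 : fps K) n = (n == 0%N)%:R. Proof. by []. Qed.
Lemma fps_coefD f g n : fps_coef (f + g) n = fps_coef f n + fps_coef g n.
Proof. by []. Qed.
Lemma fps_coefN f n : fps_coef (- f) n = - fps_coef f n.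
Proof. by []. Qed.
Lemma fps_coefM f g n :
  fps_coef (f * g) n = \sum_(i < n.+1) fps_coef f i * fps_coef g (n - i)%N.
Proof. by []. Qed.

Definition fpsC (c : K) : fps K := FPS (fun n => if n is 0%N then c else 0).
Definition fpsX : fps K := FPS (fun n => (n == 1%N)%:R).

Lemma fps_coefCM c f n : fps_coef (fpsC c * f) n = c * fps_coef f n.
Proof.
rewrite fps_coefM big_ord_recl /= subn0 big1 ?addr0 // => i _.
by rewrite /= mul0r.
Qed.

Definition fps_deriv f : fps K := FPS (fun n => fps_coef f n.+1 *+ n.+1).

(* The composite g(f), meaningful when f has zero constant term: then f ^+ k
   has no term of degree < k, and the sum over k may be cut off at n. *)
Definition fps_comp g f : fps K :=
  FPS (fun n => \sum_(k < n.+1) fps_coef g k * fps_coef (f ^+ k) n).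

Definition fps_exp f : fps K := fps_comp (FPS (fun k => (k`!)%:R^-1)) f.

Lemma fps_coefX_small f k n : fps_coef f 0 = 0 -> (n < k)%N ->
  fps_coef (f ^+ k) n = 0.
Proof.
move=> f0; elim: k n => // k IHk n; rewrite ltnS => nk.
rewrite exprS fps_coefM big_ord_recl /= f0 mul0r add0r big1 // => i _ /=.
rewrite IHk ?mulr0 // /bump /= add1n; apply: leq_trans nk.
by have := ltn_ord i; case: n i => [[]|n i _]//; rewrite subSS ltnS leq_subr.
Qed.

(* The inverse is the geometric series: with c the constant term of f,
   f = c (1 - (1 - c^-1 f)). *)
Definition fps_unit : pred (fps K) := fun f => fps_coef f 0 != 0.
Definition fps_inv f : fps K :=
  if fps_coef f 0 == 0 then f else
  fpsC (fps_coef f 0)^-1 *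
  fps_comp (FPS (fun=> 1)) (1 - fpsC (fps_coef f 0)^-1 * f).

Let fps_geom f : fps_coef f 0 = 0 -> (1 - f) * fps_comp (FPS (fun=> 1)) f = 1.
Proof.
move=> f0; apply: fpsP => n.
have geomE m N : (m <= N)%N -> fps_coef (fps_comp (FPS (fun=> 1)) f) m
    = \sum_(k < N.+1) fps_coef (f ^+ k) m.
  move=> mN; rewrite /= (eq_bigr (fun k : 'I__ => fps_coef (f ^+ k) m));
    last by move=> k _; rewrite mul1r.
  rewrite (big_ord_widen N.+1 (fun k => fps_coef (f ^+ k) m)) //.
  rewrite big_mkcond /=; apply: eq_bigr => k _; case: ifPn => //.
  by rewrite -leqNgt => mk; rewrite fps_coefX_small.
rewrite mulrBl mul1r fps_coefD fps_coefN (geomE n n) // fps_coefM.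
under [X in _ - X]eq_bigr => i _ do rewrite (geomE _ n) ?leq_subr // big_distrr /=.
rewrite exchange_big /=.
under [X in _ - X]eq_bigr => k _ do rewrite -fps_coefM -exprS.
rewrite big_ord_recl big_ord_recr /= (@fps_coefX_small _ n.+1) // addr0.
by rewrite addrK.
Qed.

Fact fps_mulV : {in fps_unit, left_inverse 1 fps_inv *%R}.
Proof.
move=> f; rewrite unfold_in => f0; rewrite /fps_inv (negbTE f0).
set c := fps_coef f 0; set g := fpsC c^-1 * f.
rewrite mulrAC -/g -[X in X * _](subKr 1) fps_geom //.
by rewrite fps_coefD fps_coefN fps_coefCM fps_coef1 /= mulVf ?subrr.
Qed.

Fact fps_unitP f g : g * f = 1 -> fps_unit f.
Proof.
move=> /(congr1 (fun h => fps_coef h 0)).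
rewrite fps_coefM big_ord_recl big_ord0 addr0 fps_coef1 /= => gf.
apply/eqP => f0; move/eqP: gf.
by rewrite f0 mulr0 eq_sym oner_eq0.
Qed.

Fact fps_inv_out : {in [predC fps_unit], fps_inv =1 id}.
Proof. by move=> f; rewrite inE unfold_in negbK /fps_inv => ->. Qed.

HB.instance Definition _ := GRing.ComNzRing_hasMulInverse.Build (fps K)
  fps_mulV fps_unitP fps_inv_out.

Lemma fps_unitE f : (f \is a GRing.unit) = (fps_coef f 0 != 0).
Proof. by []. Qed.

End Fps.

Arguments fpsX {K}.

(** * Regions of an arrangement *)

Definition regions (T : topologicalType) (V : set T) (A : set (set T)) :
    set (set T) :=
  let U := V `\` \bigcup_(H in A) H in connected_component U @` U.

Section Generic.
Variable R : realType.

Definition sum0_space (n : nat) : set 'rV[R]_n :=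
  [set x | \sum_(i < n) x 0 i = 0].

(* Indices start at 0: [a i] stands for a_(i+1). *)
Definition arrangement_G (a : nat -> R) (n : nat) : set (set 'rV[R]_n) :=
  [set H | exists i j : 'I_n, i != j /\
     H = [set x | sum0_space x /\ x 0 i - x 0 j = a i]].

Definition nb_regions_G (a : nat -> R) (n : nat) : nat :=
  if n is 0%N then 1%N
  else #|` fset_set (regions (@sum0_space n) (@arrangement_G a n))|%fset.

(* A set of the hyperplanes x_i - x_j = a_i is a graph on the indices, and it
   has a common point iff the labels, signed by direction of travel, sum to 0
   around every cycle.  Each index occurs in such a cycle sum with coefficient
   -1, 0 or 1, and every nonzero such coefficient vector comes from some cycle.
   So the condition below says exactly that sets of hyperplanes have no common
   point unless they have one for all values of the parameters.  It excludes,
   for each n, a finite union of proper hyperplanes in the space of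
   (a_0, ..., a_(n-1)). *)
Definition generic (a : nat -> R) : Prop :=
  forall (n : nat) (c : 'I_n -> int),
    (forall i, c i \in [:: -1; 0; 1]) ->
    \sum_(i < n) (c i)%:~R * a i = 0 -> forall i, c i = 0.

Definition Q_independent (a : nat -> R) : Prop :=
  forall (n : nat) (c : 'I_n -> rat),
    \sum_(i < n) ratr (c i) * a i = 0 -> forall i, c i = 0.

Lemma Q_independent_generic (a : nat -> R) : Q_independent a -> generic a.
Proof.
move=> aQ n c _ ca i; apply/eqP; rewrite -(intr_eq0 rat); apply/eqP.
apply: (aQ n (fun i => (c i)%:~R)); rewrite -[RHS]ca.
by apply: eq_bigr => j _; rewrite ratr_int.
Qed.

Definition z_series (a : nat -> R) : fps R :=
  FPS (fun n => (nb_regions_G a n)%:R / (n`!)%:R).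

End Generic.

(* f = s_0 + s_1 x + s_2 x^2/2! + ... as far as the list s goes. *)
Definition egf_begins (K : fieldType) (f : fps K) (s : seq nat) : Prop :=
  forall n : nat, (n < size s)%N -> fps_coef f n = (nth 0%N s n)%:R / (n`!)%:R.

(* Main.v *)
(** Write l_i = x_i - a_i, so that the hyperplanes compare the l_i with the x_j.
    Everything is a count of the sign patterns realised by a finite list of
    hyperplanes x_u - x_v = g.  By deletion-restriction such a count is a signed
    sum over the consistent sublists (Whitney).

    Let Z_n be the number of cells of G_n, and P_n the number of cells after
    adding one free point s that is compared with all the x_j (equivalently, by
    reflection, with all the l_j).  Adding to an arrangement through a vertex s
    a further bundle of hyperplanes at s multiplies the generating function by
    y = P/Z: in the Whitney sum, genericity forbids a cycle through s which uses
    both the old and the new bundle, so the vertices reached through the new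
    bundle can be split off.  As a vertex b of G_n carries two bundles, x_b being
    compared with the l_j and l_b with the x_j, this gives Z' = y^2 Z.  On the
    other hand, restricting to the flat where s = x_j exactly for j in a chosen
    nonempty N merges N into one vertex that carries one bundle of type l and
    |N| bundles of type x, so that P = Z + (exp(x y) - 1) y Z. *)
Require Import Defs.
From mathcomp Require Import all_boot all_order all_algebra.
From mathcomp Require Import all_classical all_reals all_analysis.
From mathcomp Require Import finmap ring lra.
Import Order.TTheory GRing.Theory Num.Theory numFieldNormedType.Exports.
Set Implicit Arguments.
Unset Strict Implicit.
Unset Printing Implicit Defensive.
Local Open Scope classical_set_scope.
Local Open Scope ring_scope.

(** * Sign cells *)

Section SignCells.
Variables (R : realType) (X : Type).
Implicit Types (F G : set X) (h g : X -> R) (L : seq (X -> R)).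

Fixpoint cells F L : seq (set X) :=
  if L is h :: L' then cells (F `&` [set x | 0 < h x]) L' ++
                       cells (F `&` [set x | h x < 0]) L'
  else if `[< F !=set0 >] then [:: F] else [::].

Definition ncells F L : nat := size (cells F L).

Lemma ncells_nil F : ncells F [::] = `[< F !=set0 >] :> nat.
Proof. by rewrite /ncells /=; case: ifP. Qed.

Lemma ncells_cons F h L : ncells F (h :: L) =
  addn (ncells (F `&` [set x | 0 < h x]) L) (ncells (F `&` [set x | h x < 0]) L).
Proof. by rewrite /ncells /= size_cat. Qed.

Lemma ncells_set0 L : ncells set0 L = 0%N.
Proof.
elim: L => [|h L IHL]; last by rewrite ncells_cons !set0I IHL.
by rewrite ncells_nil; case: asboolP => // -[].
Qed.

Definition same_signs L (x y : X) := {in L, forall h, 0 < h x * h y}.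

Lemma ncells_redundant F h L :
  (forall x y, F x -> F y -> same_signs L x y -> 0 < h x * h y) ->
  ncells F (h :: L) = ncells F L.
Proof.
elim: L F => [|g L IHL] F redh.
  have hne x : F x -> h x != 0.
    by move=> Fx; have := redh x x Fx Fx (fun _ => ltac:(by [])); rewrite -expr2 exprn_even_gt0.
  rewrite ncells_cons !ncells_nil; case: (asboolP (F !=set0)) => [[x Fx]|F0].
    case: (ltrgtP (h x) 0) (hne x Fx) => // hx _.
      rewrite asboolF ?asboolT //; first by exists x.
      move=> [y [Fy /= hy]]; have := redh x y Fx Fy (fun _ => ltac:(by [])).
      by rewrite nmulr_rgt0 // ltNge ltW.
    rewrite asboolT ?asboolF //; last by exists x.
    move=> [y [Fy /= hy]]; have := redh x y Fx Fy (fun _ => ltac:(by [])).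
    by rewrite pmulr_rgt0 // ltNge ltW.
  by rewrite !asboolF // => -[x [Fx _]]; apply: F0; exists x.
rewrite [RHS]ncells_cons -!IHL.
- rewrite !ncells_cons -!setIA ![[set x | h _ < 0] `&` _]setIC.
  by rewrite ![[set x | 0 < h _] `&` _]setIC addnACA.
- move=> x y [Fx gx] [Fy gy] s; apply: redh => // f.
  by rewrite inE => /orP[/eqP->|/s//]; rewrite nmulr_rgt0.
- move=> x y [Fx gx] [Fy gy] s; apply: redh => // f.
  by rewrite inE => /orP[/eqP->|/s//]; rewrite pmulr_rgt0.
Qed.

Lemma ncells_swap F h L1 L2 :
  ncells F (h :: L1 ++ L2) = ncells F (L1 ++ h :: L2).
Proof.
elim: L1 F => //= g L1 IHL F; rewrite [RHS]ncells_cons -!IHL !ncells_cons.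
rewrite -!setIA ![[set x | h _ < 0] `&` _]setIC.
by rewrite ![[set x | 0 < h _] `&` _]setIC addnACA.
Qed.

Lemma ncells_catC F L1 L2 : ncells F (L1 ++ L2) = ncells F (L2 ++ L1).
Proof.
elim: L1 F => [|h L1 IHL] F; first by rewrite cats0.
by rewrite /= -ncells_swap !ncells_cons !IHL.
Qed.

Lemma ncells_redundant_cat F L1 L2 :
  (forall x y, F x -> F y -> same_signs L2 x y -> same_signs L1 x y) ->
  ncells F (L1 ++ L2) = ncells F L2.
Proof.
elim: L1 => //= h L1 IHL red12.
rewrite ncells_redundant ?IHL //.
  by move=> x y Fx Fy /red12-/(_ Fx Fy) s g gL; apply: s; rewrite inE gL orbT.
move=> x y Fx Fy s; apply: (red12 x y Fx Fy); last by rewrite inE eqxx.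
by move=> g gL; apply: s; rewrite mem_cat gL orbT.
Qed.

Lemma ncells_same_signs F L1 L2 :
  (forall x y, F x -> F y -> same_signs L1 x y <-> same_signs L2 x y) ->
  ncells F L1 = ncells F L2.
Proof.
move=> eq12; rewrite -(@ncells_redundant_cat F L2 L1); last first.
  by move=> x y Fx Fy s; apply/(eq12 x y Fx Fy).
rewrite ncells_catC ncells_redundant_cat // => x y Fx Fy.
by move=> s; apply/(eq12 x y Fx Fy).
Qed.

End SignCells.

Lemma ncells_pull (R : realType) (X Y : Type) (f : Y -> X) (F : set X) (G : set Y)
    (L : seq (X -> R)) :
  f @` G = F -> ncells F L = ncells G [seq h \o f | h <- L].
Proof.
move=> <-; elim: L G => [|h L IHL] G.
  rewrite !ncells_nil; congr (nat_of_bool _); apply: asbool_equiv_eq; split.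
    by move=> [_ [y Gy _]]; exists y.
  by move=> [y Gy]; exists (f y), y.
rewrite map_cons !ncells_cons -!IHL; congr addn; congr (ncells _ _).
  by apply/seteqP; split=> [_ [[y Gy <-] hy]|_ [y [Gy hy] <-]];
    [exists y|split => //; exists y].
by apply/seteqP; split=> [_ [[y Gy <-] hy]|_ [y [Gy hy] <-]];
  [exists y|split => //; exists y].
Qed.

Lemma ncells_transfer (R : realType) (X Y : Type) (F : set X) (G : set Y)
    (rho : X -> Y -> Prop) (L : seq (X -> R)) (M : seq (Y -> R)) :
  (forall x, F x -> exists2 y, G y & rho x y) ->
  (forall y, G y -> exists2 x, F x & rho x y) ->
  (forall x y x' y', rho x y -> rho x' y' ->
     same_signs L x x' <-> same_signs M y y') ->
  ncells F L = ncells G M.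
Proof.
move=> FG GF LM; pose H : set (X * Y) := [set p | [/\ F p.1, G p.2 & rho p.1 p.2]].
rewrite (@ncells_pull _ _ _ fst F H); last first.
  apply/seteqP; split=> [_ [p [? ? ?] <-]//|x Fx].
  by have [y Gy xy] := FG x Fx; exists (x, y).
rewrite (@ncells_pull _ _ _ snd G H); last first.
  apply/seteqP; split=> [_ [p [? ? ?] <-]//|y Gy].
  by have [x Fx xy] := GF y Gy; exists (x, y).
apply: ncells_same_signs => -[x y] [x' y'] [_ _ /= xy] [_ _ /= xy'].
have comp_signs (Z : Type) (f : X * Y -> Z) (K : seq (Z -> R)) p q :
    same_signs [seq h \o f | h <- K] p q <-> same_signs K (f p) (f q).
  split=> s h; last by move=> /mapP[g gK ->]; apply: s.
  by move=> hK; apply: (s (h \o f)); apply: map_f.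
by rewrite !comp_signs; apply: LM.
Qed.

(** * Deletion-restriction and Whitney's formula *)

Fixpoint sublists (T : Type) (s : seq T) : seq (seq T) :=
  if s is x :: s' then sublists s' ++ map (cons x) (sublists s') else [:: [::]].

Lemma big_sublists_filter (A : nmodType) (T : Type) (p : pred T) (s : seq T)
    (f : seq T -> A) :
  \sum_(B <- sublists [seq x <- s | p x]) f B = \sum_(B <- sublists s | all p B) f B.
Proof.
elim: s f => [|x s IHs] f /=; first by rewrite !big_seq1 big_mkcond big_seq1.
case: ifPn => px /=; rewrite !big_cat /= !big_map /= IHs.
  by congr (_ + _); rewrite IHs; apply: eq_bigl => B; rewrite px.
rewrite [X in _ + X]big1 ?addr0 // => B /andP[px'].
by rewrite px' in px.
Qed.

Lemma big_sublists_map (A : nmodType) (T U : Type) (g : T -> U) (s : seq T)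
    (f : seq U -> A) :
  \sum_(B <- sublists (map g s)) f B = \sum_(B <- sublists s) f (map g B).
Proof.
elim: s f => [|x s IHs] f /=; first by rewrite !big_seq1.
by rewrite !big_cat /= !big_map /= !IHs.
Qed.

Lemma big_sublists_cat (A : nmodType) (T : Type) (s1 s2 : seq T)
    (f : seq T -> A) :
  \sum_(B <- sublists (s1 ++ s2)) f B =
  \sum_(B1 <- sublists s1) \sum_(B2 <- sublists s2) f (B1 ++ B2).
Proof.
elim: s1 f => [|x s IHs] f /=; first by rewrite big_seq1.
by rewrite !big_cat /= !big_map /= !IHs.
Qed.

Lemma sublists_subset (T : eqType) (s B : seq T) :
  B \in sublists s -> {subset B <= s}.
Proof.
elim: s B => [|x s IHs] B /=; first by rewrite inE => /eqP->.
rewrite mem_cat => /orP[/IHs Bs y /Bs ys|]; first by rewrite inE ys orbT.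
move=> /mapP[C /IHs Cs ->] y; rewrite !inE => /orP[->//|/Cs->].
by rewrite orbT.
Qed.

Section Whitney.
Variables (R : realType) (V : eqType).
Implicit Types (F G : set (V -> R)) (h : V * V * R) (H : seq (V * V * R)).

Definition hyp h (x : V -> R) : R := x h.1.1 - x h.1.2 - h.2.

Definition translate (x : V -> R) (t : R) (y z : V -> R) : V -> R :=
  fun v => x v + t * (y v - z v).

Lemma hyp_translate h x t y z :
  hyp h (translate x t y z) = hyp h x + t * (hyp h y - hyp h z).
Proof. by rewrite /hyp /translate; ring. Qed.

Definition affine_set F :=
  forall x t y z, F x -> F y -> F z -> F (translate x t y z).

Definition hcells F H := ncells F [seq hyp h | h <- H].

Lemma hcells_cons F h H : hcells F (h :: H) =
  addn (hcells (F `&` [set x | 0 < hyp h x]) H)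
       (hcells (F `&` [set x | hyp h x < 0]) H).
Proof. by rewrite /hcells map_cons ncells_cons. Qed.

Lemma hcells_set0 H : hcells set0 H = 0%N.
Proof. exact: ncells_set0. Qed.

Lemma hcells_split G h H y z :
    (forall x1 x2 t, G x1 -> G x2 -> 0 <= t <= 1 -> G (translate x1 t x2 x1)) ->
    (forall x, G x -> exists2 e : R, 0 < e &
       forall t, `|t| <= e -> G (translate x t y z)) ->
    hyp h y != hyp h z ->
  addn (hcells (G `&` [set x | 0 < hyp h x]) H)
       (hcells (G `&` [set x | hyp h x < 0]) H) =
  addn (hcells G H) (hcells (G `&` [set x | hyp h x = 0]) H).
Proof.
move=> + + hyz; elim: H G => [|g H IHH] G Gconv Gopen.
  rewrite /hcells /= !ncells_nil.
  have pz : (G `&` [set x | 0 < hyp h x]) !=set0 ->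
      (G `&` [set x | hyp h x < 0]) !=set0 -> (G `&` [set x | hyp h x = 0]) !=set0.
    move=> [x1 [G1 /= h1]] [x2 [G2 /= h2]].
    have h12 : 0 < hyp h x1 - hyp h x2 by rewrite subr_gt0 (lt_trans h2).
    exists (translate x1 (hyp h x1 / (hyp h x1 - hyp h x2)) x2 x1); split.
      apply: Gconv => //; apply/andP; split; first by rewrite divr_ge0 ?ltW.
      by rewrite ler_pdivrMr // mul1r lerDl oppr_ge0 ltW.
    by rewrite /= hyp_translate; field; rewrite lt0r_neq0.
  have zp : (G `&` [set x | hyp h x = 0]) !=set0 ->
      (G `&` [set x | 0 < hyp h x]) !=set0 /\ (G `&` [set x | hyp h x < 0]) !=set0.
    move=> [x [Gx /= hx]]; have [e e0 Ge] := Gopen x Gx.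
    have Gp := Ge e; have Gm := Ge (- e).
    rewrite normrN (gtr0_norm e0) lexx in Gp Gm.
    have hp := hyp_translate h x e y z; have hm := hyp_translate h x (- e) y z.
    rewrite hx add0r in hp; rewrite hx add0r mulNr in hm.
    case: (ltgtP (hyp h y) (hyp h z)) hyz => // hyz _.
      split; [exists (translate x (- e) y z)|exists (translate x e y z)].
        by split; [exact: Gm|rewrite /= hm oppr_gt0 pmulr_rlt0 // subr_lt0].
      by split; [exact: Gp|rewrite /= hp pmulr_rlt0 // subr_lt0].
    split; [exists (translate x e y z)|exists (translate x (- e) y z)].
      by split; [exact: Gp|rewrite /= hp pmulr_rgt0 // subr_gt0].
    by split; [exact: Gm|rewrite /= hm oppr_lt0 pmulr_rgt0 // subr_gt0].
  case: (asboolP ((G `&` [set x | 0 < hyp h x]) !=set0)) => p;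
  case: (asboolP ((G `&` [set x | hyp h x < 0]) !=set0)) => m;
  case: (asboolP (G `&` [set x | hyp h x = 0] !=set0)) => // o;
  case: (asboolP (G !=set0)) => //= Gn; exfalso; try tauto.
  - by case: p => x [Gx _]; apply: Gn; exists x.
  - by case: p => x [Gx _]; apply: Gn; exists x.
  - by case: m => x [Gx _]; apply: Gn; exists x.
  - by case: Gn => x Gx; case: (ltrgtP (hyp h x) 0) => hx;
      [apply: m|apply: p|apply: o]; exists x.
rewrite !hcells_cons addnACA [in RHS]addnACA.
have sub s : (forall x1 x2 t, G x1 -> 0 < s * hyp g x1 -> G x2 ->
     0 < s * hyp g x2 -> 0 <= t <= 1 -> 
     G (translate x1 t x2 x1) /\ 0 < s * hyp g (translate x1 t x2 x1)) /\
   (forall x, G x -> 0 < s * hyp g x -> exists2 e : R, 0 < e & forall t, `|t| <= e ->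
     G (translate x t y z) /\ 0 < s * hyp g (translate x t y z)).
  split=> [x1 x2 t G1 g1 G2 g2 t01|x Gx gx].
    split; first exact: Gconv.
    rewrite hyp_translate; case/andP: t01 => t0 t1.
    rewrite (_ : s * _ = (1 - t) * (s * hyp g x1) + t * (s * hyp g x2)); last by ring.
    have [->|t_neq1] := eqVneq t 1; first by rewrite subrr mul0r add0r mul1r.
    apply: ltr_pwDl; last by rewrite mulr_ge0 // ltW.
    by rewrite mulr_gt0 // subr_gt0 lt_neqAle t_neq1.
  have [e e0 Ge] := Gopen x Gx.
  pose d := `|s * (hyp g y - hyp g z)| + 1.
  have d0 : 0 < d by rewrite ltr_wpDl.
  exists (Num.min e (s * hyp g x / (2 * d))).
    by rewrite lt_min e0 divr_gt0 // mulr_gt0.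
  move=> t; rewrite le_min => /andP[te td]; split; first exact: Ge.
  rewrite hyp_translate mulrDr mulrCA.
  have: `|t * (s * (hyp g y - hyp g z))| < s * hyp g x.
    rewrite normrM; apply: (@le_lt_trans _ _ (`|t| * d)).
      by rewrite ler_wpM2l // lerDl.
    apply: (@le_lt_trans _ _ (s * hyp g x / (2 * d) * d)).
      by rewrite ler_pM2r.
    rewrite (_ : s * hyp g x / (2 * d) * d = s * hyp g x / 2); last first.
      by field; rewrite lt0r_neq0.
    lra.
  by rewrite ltr_norml => /andP[+ _]; lra.
have swap (P : R -> Prop) B :
  G `&` [set x | P (hyp h x)] `&` B = G `&` B `&` [set x | P (hyp h x)].
  by rewrite setIAC.
rewrite !(swap (fun r => 0 < r)) !(swap (fun r => r < 0)) !(swap (fun r => r = 0)).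
congr addn; apply: IHH.
- move=> x1 x2 t [G1 /= g1] [G2 /= g2] t01.
  by have [+ _] := sub 1 => /(_ x1 x2 t); rewrite /= !mul1r; apply.
- move=> x [Gx /= gx]; have [_ /(_ x)] := sub 1; rewrite !mul1r => /(_ Gx gx)[e e0 He].
  by exists e => // t /He; rewrite mul1r.
- move=> x1 x2 t [G1 /= g1] [G2 /= g2] t01.
  have [+ _] := sub (-1) => /(_ x1 x2 t); rewrite /= !mulN1r !oppr_gt0.
  by apply.
- move=> x [Gx /= gx]; have [_ /(_ x)] := sub (-1).
  rewrite !mulN1r !oppr_gt0 => /(_ Gx gx)[e e0 He].
  by exists e => // t /He; rewrite mulN1r oppr_gt0.
Qed.

Lemma hcells_deletion F h H : affine_set F -> ~ (F `<=` [set x | hyp h x = 0]) ->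
  hcells F (h :: H) = addn (hcells F H) (hcells (F `&` [set x | hyp h x = 0]) H).
Proof.
move=> Faff hF; have [[y [z [Fy Fz hyz]]]|hconst] :=
    pselect (exists y z, [/\ F y, F z & hyp h y != hyp h z]).
  rewrite hcells_cons; apply: (hcells_split H _ _ hyz).
    by move=> x1 x2 t F1 F2 _; apply: Faff.
  by move=> x Fx; exists 1 => // t _; apply: Faff.
have {}hconst y z : F y -> F z -> hyp h y = hyp h z.
  move=> Fy Fz; apply: contrapT => /eqP yz; apply: hconst.
  by exists y, z.
rewrite /hcells map_cons ncells_redundant; last first.
  move=> x y Fx Fy _; rewrite (hconst y x) // -expr2 exprn_even_gt0 //=.
  apply/eqP => hx; apply: hF => z Fz /=.
  by rewrite (hconst z x).
rewrite (_ : _ `&` _ = set0) ?ncells_set0 ?addn0 //.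
rewrite -subset0 => x [Fx /= hx]; apply: hF => z Fz /=.
by rewrite (hconst z x).
Qed.

Lemma affine_setI F h : affine_set F ->
  affine_set (F `&` [set x | hyp h x = 0]).
Proof.
move=> Faff x t y z [Fx /= hx] [Fy /= hy] [Fz /= hz]; split; first exact: Faff.
by rewrite /= hyp_translate hx hy hz subrr mulr0 addr0.
Qed.

(* This is [(-1) ^ (size H - rank H)], with the rank taken on [F], if the
   hyperplanes of [H] meet inside [F], and [0] otherwise. *)
Fixpoint weight F H : int :=
  if H is h :: H' then
    if `[< F `<=` [set x | hyp h x = 0] >] then - weight F H'
    else weight (F `&` [set x | hyp h x = 0]) H'
  else `[< F !=set0 >]%:Z.

Lemma whitney F H : affine_set F ->
  (hcells F H)%:Z = \sum_(B <- sublists H) weight F B.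
Proof.
elim: H F => [|h H IHH] F Faff.
  by rewrite big_seq1 /hcells /= ncells_nil.
rewrite /= big_cat big_map /=; case: asboolP => [hF|hF].
  rewrite sumrN subrr hcells_cons.
  rewrite (_ : _ `&` _ = set0) ?hcells_set0; last first.
    by rewrite -subset0 => x [/hF/= ->]; rewrite ltxx.
  rewrite (_ : _ `&` _ = set0) ?hcells_set0 //.
  by rewrite -subset0 => x [/hF/= ->]; rewrite ltxx.
by rewrite hcells_deletion // PoszD !IHH //; exact: affine_setI.
Qed.

Lemma weight_inconsistent F H :
  (forall x, F x -> ~ {in H, forall h, hyp h x = 0}) -> weight F H = 0.
Proof.
elim: H F => [|h H IHH] F Fincons /=.
  by rewrite asboolF // => -[x /Fincons]; apply.
case: asboolP => hF.
  rewrite IHH ?oppr0 // => x Fx Hx; apply: (Fincons x Fx) => g.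
  by rewrite inE => /orP[/eqP->|/Hx//]; apply: hF.
apply: IHH => x [Fx hx] Hx; apply: (Fincons x Fx) => g.
by rewrite inE => /orP[/eqP->|/Hx].
Qed.

Lemma weight_transfer F G H K : size H = size K ->
  (forall x, F x -> exists2 y, G y & [seq hyp h x | h <- H] = [seq hyp h y | h <- K]) ->
  (forall y, G y -> exists2 x, F x & [seq hyp h x | h <- H] = [seq hyp h y | h <- K]) ->
  weight F H = weight G K.
Proof.
elim: H K F G => [|h H IHH] [|k K] F G //=.
  move=> _ FG GF; congr (_%:Z); congr nat_of_bool; apply: asbool_equiv_eq.
  by split=> [[x /FG[y]]|[y /GF[x]]]; [exists y|exists x].
move=> [sHK] FG GF.
have -> : `[< F `<=` [set x | hyp h x = 0] >] = `[< G `<=` [set x | hyp k x = 0] >].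
  apply: asbool_equiv_eq; split=> [hF y /GF[x Fx] []|kG x /FG[y Gy] []] /=.
    by move=> <- _; apply: hF.
  by move=> -> _; apply: kG.
case: ifP => _; [congr (- _)|]; apply: IHH => //.
- by move=> x /FG[y Gy [_ HK]]; exists y.
- by move=> y /GF[x Fx [_ HK]]; exists x.
- by move=> x [/FG[y Gy [hk HK]] /= hx]; exists y => //; split=> //=; rewrite -hk.
- by move=> y [/GF[x Fx [hk HK]] /= ky]; exists x => //; split=> //=; rewrite hk.
Qed.

Lemma hcells_mul (A : pred V) F G H K :
  (forall x y, {in A, x =1 y} -> F x -> F y) ->
  (forall x y, {in predC A, x =1 y} -> G x -> G y) ->
  {in H, forall h, A h.1.1 && A h.1.2} ->
  {in K, forall h, ~~ A h.1.1 && ~~ A h.1.2} ->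
  hcells (F `&` G) (H ++ K) = (hcells F H * hcells G K)%N.
Proof.
elim: H F G => [|h H IHH] F G FA GA HA KA /=.
  elim: K G GA KA => [|k K IHK] G GA KA.
    rewrite /hcells /= !ncells_nil mulnb; congr nat_of_bool.
    rewrite -asbool_and; apply: asbool_equiv_eq; split.
      by move=> [x [Fx Gx]]; split; exists x.
    move=> [[x Fx] [y Gy]]; exists (fun v => if A v then x v else y v); split.
      by apply: (FA x) => // v; rewrite unfold_in => ->.
    by apply: (GA y) => // v; rewrite unfold_in /= => /negbTE->.
  have /andP[/negbTE k1 /negbTE k2] := KA k (mem_head _ _).
  rewrite !hcells_cons mulnDr -!setIA; congr addn; apply: IHK.
  - move=> x y xy [Gx /= kx]; split; first exact: (GA x).
    by rewrite /= /hyp -!xy // unfold_in /= ?k1 ?k2.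
  - by move=> g gK; apply: KA; rewrite inE gK orbT.
  - move=> x y xy [Gx /= kx]; split; first exact: (GA x).
    by rewrite /= /hyp -!xy // unfold_in /= ?k1 ?k2.
  - by move=> g gK; apply: KA; rewrite inE gK orbT.
have /andP[h1 h2] := HA h (mem_head _ _).
rewrite !hcells_cons mulnDl !(setIAC F G); congr addn; apply: IHH => //.
- move=> x y xy [Fx /= hx]; split; first exact: (FA x).
  by rewrite /= /hyp -!xy.
- by move=> g gH; apply: HA; rewrite inE gH orbT.
- move=> x y xy [Fx /= hx]; split; first exact: (FA x).
  by rewrite /= /hyp -!xy.
- by move=> g gH; apply: HA; rewrite inE gH orbT.
Qed.
End Whitney.

(** * Bundles of hyperplanes at a vertex *)

Lemma hcells_transfer (R : realType) (V W : eqType) (F : set (V -> R))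
    (G : set (W -> R)) (rho : (V -> R) -> (W -> R) -> Prop)
    (H : seq (V * V * R)) (K : seq (W * W * R)) :
  (forall x, F x -> exists2 y, G y & rho x y) ->
  (forall y, G y -> exists2 x, F x & rho x y) ->
  {in H, forall h,
     (exists k e, [/\ k \in K, e != 0 & forall x y, rho x y -> hyp h x = e * hyp k y])
     \/ exists2 c, c != 0 & forall x y, rho x y -> hyp h x = c} ->
  {in K, forall k, exists h e,
     [/\ h \in H, e != 0 & forall x y, rho x y -> hyp k y = e * hyp h x]} ->
  hcells F H = hcells G K.
Proof.
move=> FG GF HK KH; apply: (ncells_transfer FG GF) => x y x' y' xy xy'.
split=> s _ /mapP[h hH ->].
  have [g [e [gH e0 ge]]] := KH h hH; rewrite (ge _ _ xy) (ge _ _ xy').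
  by rewrite mulrACA mulr_gt0 ?(s _ (map_f _ gH)) // -expr2 exprn_even_gt0.
have [[k [e [kK e0 ke]]]|[c c0 hc]] := HK h hH; last first.
  by rewrite (hc _ _ xy) (hc _ _ xy') -expr2 exprn_even_gt0.
rewrite (ke _ _ xy) (ke _ _ xy').
by rewrite mulrACA mulr_gt0 ?(s _ (map_f _ kK)) // -expr2 exprn_even_gt0.
Qed.

Lemma hcells_eqi (R : realType) (V : eqType) (F : set (V -> R))
    (H K : seq (V * V * R)) : H =i K -> hcells F H = hcells F K.
Proof.
move=> HK; apply: ncells_same_signs => x y Fx Fy.
by split=> s _ /mapP[h hH ->]; apply: s; apply: map_f; rewrite ?HK // -HK.
Qed.

Section Stars.
Variables (R : realType) (V : finType) (a : V -> R).
Implicit Types (S T U : {set V}) (s v : V) (d : V -> R) (D : seq (V -> R)).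

Lemma neq_notin S s u : s \notin S -> u \in S -> (u == s) = false.
Proof. by move=> sS uS; apply: contraNF sS => /eqP<-. Qed.

Definition edges S : seq (V * V * R) :=
  [seq (p.1, p.2, a p.1) |
     p <- enum [pred p : V * V | [&& p.1 \in S, p.2 \in S & p.1 != p.2]]].

Definition spokes s S d : seq (V * V * R) := [seq (s, v, d v) | v <- enum S].

Definition star s D S : seq (V * V * R) := flatten [seq spokes s S d | d <- D].

Lemma mem_edges S h : (h \in edges S) =
  [&& h.1.1 \in S, h.1.2 \in S, h.1.1 != h.1.2 & h.2 == a h.1.1].
Proof.
case: h => [[u v] g] /=; apply/mapP/and4P => [[[u' v']]|[uS vS uv /eqP->]].
  by rewrite mem_enum inE /= => /and3P[? ? ?] [-> -> ->]; split.
by exists (u, v) => //; rewrite mem_enum inE /=; apply/and3P.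
Qed.

Lemma mem_spokes s S d h : (h \in spokes s S d) =
  [&& h.1.1 == s, h.1.2 \in S & h.2 == d h.1.2].
Proof.
case: h => [[u v] g] /=; apply/mapP/and3P => [[w]|[/eqP-> vS /eqP->]].
  by rewrite mem_enum => ? [-> -> ->]; rewrite !eqxx.
by exists v; rewrite ?mem_enum.
Qed.

Lemma mem_star s D S h : (h \in star s D S) =
  [&& h.1.1 == s, h.1.2 \in S & has (fun d => h.2 == d h.1.2) D].
Proof.
rewrite /star; elim: D => [|d D IHD] /=; first by rewrite !andbF.
by rewrite mem_cat mem_spokes IHD -!andb_orr.
Qed.

(* A hyperplane with a zero at [x] joins its two vertices, so this is the
   adjacency relation of the largest set of edges consistent at [x]. *)
Definition tight S (x : V -> R) : rel V := fun u v =>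
  [&& u \in S, v \in S & (x u - x v == a u) || (x v - x u == a v)].

Lemma tight_sym S x : symmetric (tight S x).
Proof. by move=> u v; rewrite /tight orbC andbCA. Qed.

Definition ncells_edges S := hcells setT (edges S).
Definition ncells_star s D S := hcells setT (edges S ++ star s D S).

Definition uncut s T (h : V * V * R) : bool :=
  (h.1.1 \in s |: T) == (h.1.2 \in s |: T).

Lemma uncut_weight S s1 s2 d D (B : seq (V * V * R)) (C : seq V) :
  s1 \notin S -> s2 \notin S -> s1 != s2 ->
  (forall x u v, {in D, forall d', u \in S -> v \in S ->
     connect (tight S x) u v -> x u + d u != x v + d' v}) ->
  {subset B <= edges S ++ star s1 D S} -> {subset C <= S} ->
  let BC s := B ++ [seq (s, v, d v) | v <- C] in
  \sum_(T : {set V} | (T \subset S) && all (uncut s1 T) (BC s1)) weight setT (BC s1) =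
  \sum_(T : {set V} | (T \subset S) && all (uncut s1 T) (BC s2)) weight setT (BC s2).
Proof.
move=> s1S s2S s12 cross BS CS BC.
have neqS s u : s \notin S -> u \in S -> (u == s) = false by apply: neq_notin.
have BP h : h \in B -> [/\ h.1.1 \in S, h.1.2 \in S & h.2 = a h.1.1] \/
    [/\ h.1.1 = s1, h.1.2 \in S & exists2 d', d' \in D & h.2 = d' h.1.2].
  move=> /BS; rewrite mem_cat mem_edges mem_star.
  move=> /orP[/and4P[? ? _ /eqP ?]|/and3P[/eqP ? ? /hasP[d' ? /eqP]]]; first by left.
  by right; split=> //; exists d'.
have uncut1 T v : T \subset S -> v \in S -> uncut s1 T (s1, v, d v) = (v \in T).
  by move=> TS vS; rewrite /uncut /= !inE eqxx (neqS s1).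
have uncut2 T v : T \subset S -> v \in S -> uncut s1 T (s2, v, d v) = (v \notin T).
  move=> TS vS; rewrite /uncut /= !inE [s2 == s1]eq_sym (negbTE s12) /= (neqS s1) //=.
  rewrite (_ : (s2 \in T) = false) //.
  by apply/negP => /(fintype.subsetP TS); apply/negP.
have [[x xB]|incons] := pselect (exists x, {in BC s1, forall h, hyp h x = 0}).
  pose U := [set v in S | [exists u in C, connect (tight S x) u v]]%SET.
  have symU : connect_sym (tight S x) by exact/sym_connect_sym/tight_sym.
  have xBh h : h \in B -> x h.1.1 - x h.1.2 = h.2.
    by move=> hB; apply/eqP; rewrite -subr_eq0; apply/eqP/xB; rewrite mem_cat hB.
  have xC v : v \in C -> x s1 - x v = d v.
    move=> vC; apply/eqP; rewrite -subr_eq0; apply/eqP/(xB (s1, v, d v)).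
    by rewrite mem_cat (map_f (fun v => (s1, v, d v))) ?orbT.
  have US v : v \in U -> v \in S by rewrite inE => /andP[].
  have CU v : v \in C -> v \in U.
    by move=> vC; rewrite inE CS //; apply/exists_inP; exists v.
  have s1U : (s1 \in U) = false by apply: contraNF s1S; apply: US.
  have edgeU h : h \in B -> h.1.1 \in S -> h.1.2 \in S -> h.2 = a h.1.1 ->
      (h.1.1 \in U) = (h.1.2 \in U).
    move=> hB h1 h2 ha; rewrite !inE h1 h2; apply: eq_existsb => u.
    congr (_ && _); apply: same_connect_r => //; apply: connect1.
    by rewrite /tight h1 h2 (xBh h) // ha eqxx.
  have starU h : h \in B -> h.1.1 = s1 ->
      (exists2 d', d' \in D & h.2 = d' h.1.2) -> (h.1.2 \in U) = false.
    move=> hB h1 [d' d'D hd']; apply/negP => h2U; have h2S := US _ h2U.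
    move: h2U; rewrite inE h2S => /exists_inP[u uC ucon].
    have /eqP := cross x u h.1.2 d' d'D (CS u uC) h2S ucon; apply.
    have := xC u uC; have := xBh h hB; rewrite h1 hd' => <- <-; ring.
  have -> : weight setT (BC s2) = weight setT (BC s1).
    apply: weight_transfer => [|y _|y _]; first by rewrite !size_cat !size_map.
      exists (fun v => if v \in U then y v + (y s1 - y s2) else y v) => //.
      rewrite !map_cat -!map_comp; congr (_ ++ _); apply/eq_in_map.
        move=> h hB; rewrite /hyp; case: (BP h hB) => -[h1 h2 h3].
          by rewrite (edgeU h) //; case: ifP => // _; ring.
        by rewrite h1 s1U (starU h).
      by move=> v vC; rewrite /= /hyp /= s1U CU //; ring.
    exists (fun v => if v == s2 then y s1 else y v) => //.
    rewrite !map_cat -!map_comp; congr (_ ++ _); apply/eq_in_map.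
      move=> h hB; rewrite /hyp; case: (BP h hB) => -[h1 h2 h3].
        by rewrite !(neqS s2).
      by rewrite h1 (negbTE s12) (neqS s2).
    by move=> v vC; rewrite /= /hyp /= eqxx (neqS s2) // CS.
  pose f T := ((T :\: U) :|: (U :\: T))%SET.
  have inf T v : (v \in f T) = (v \in T) (+) (v \in U).
    by rewrite /f finset.in_setU !finset.in_setD; case: (v \in T); case: (v \in U).
  have fK : involutive f.
    by move=> T; apply/setP => v; rewrite !inf -addbA addbb addbF.
  have fS T : T \subset S -> f T \subset S.
    move=> TS; apply/fintype.subsetP => v; rewrite inf.
    case: (boolP (v \in T)) => [/(fintype.subsetP TS)//|_] /=.
    exact: US.
  rewrite (reindex_onto f f) => [|T _]; last exact: fK.
  apply: eq_bigl => T; rewrite fK eqxx andbT.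
  have [TS|TS] := boolP (T \subset S); last first.
    by rewrite (_ : (f T \subset S) = false) //; apply: contraNF TS => /fS; rewrite fK.
  rewrite fS //= !all_cat !all_map; congr (_ && _); apply: eq_in_all.
    move=> h hB; case: (BP h hB) => -[h1 h2 h3].
      rewrite /uncut !finset.in_setU1 !(neqS s1) //= !inf (edgeU h) //.
      by case: (_ \in U); rewrite ?addbF // !addbT; case: (_ \in T); case: (_ \in T).
    by rewrite /uncut h1 !finset.in_setU1 eqxx !inf (starU h) // addbF.
  move=> v vC; rewrite /= uncut1 ?fS // ?uncut2 // ?CS //.
  by rewrite inf CU // addbT.
rewrite !big1 // => T /andP[TS Tuncut].
  apply: weight_inconsistent => x _ xB; apply: incons.
  exists (fun v => if v \in S :\: T then x v + (x s1 - x s2) else x v).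
  move=> h; rewrite mem_cat => /orP[hB|/mapP[v vC ->]].
    have := xB h; rewrite mem_cat hB => /(_ isT); rewrite /hyp.
    have := allP Tuncut h; rewrite mem_cat hB => /(_ isT); rewrite /uncut !finset.in_setU1.
    case: (BP h hB) => -[h1 h2 h3].
      rewrite !(neqS s1) //= !finset.in_setD h1 h2 => /eqP->.
      by case: ifP => // _ <-; ring.
    by rewrite h1 eqxx !finset.in_setD (negbTE s1S) andbF (neqS s1) //= => /eqP<-.
  have vS := CS v vC.
  have mem2 : (s2, v, d v) \in BC s2.
    by rewrite mem_cat (map_f (fun v => (s2, v, d v))) ?orbT.
  have := xB _ mem2; have := allP Tuncut _ mem2; rewrite uncut2 // /hyp /=.
  by rewrite !finset.in_setD (negbTE s1S) andbF vS => -> /= <-; ring.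
apply: weight_inconsistent => x _ xB; apply: incons.
by exists x.
Qed.

Lemma star_cons_mul S s1 s2 d D :
  s1 \notin S -> s2 \notin S -> s1 != s2 ->
  (forall x u v, {in D, forall d', u \in S -> v \in S ->
     connect (tight S x) u v -> x u + d u != x v + d' v}) ->
  (\sum_(T : {set V} | T \subset S)
     ncells_star s1 (d :: D) T * ncells_edges (S :\: T)%SET =
   \sum_(T : {set V} | T \subset S)
     ncells_star s1 D T * ncells_star s2 [:: d] (S :\: T)%SET)%N.
Proof.
move=> s1S s2S s12 cross.
pose L s := (edges S ++ star s1 D S) ++ [seq (s, v, d v) | v <- enum S].
have neqS s u : s \notin S -> u \in S -> (u == s) = false by apply: neq_notin.
have memL s h : h \in L s = [|| [&& h.1.1 \in S, h.1.2 \in S, h.1.1 != h.1.2 & h.2 == a h.1.1],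
    [&& h.1.1 == s1, h.1.2 \in S & has (fun d => h.2 == d h.1.2) D] |
    [&& h.1.1 == s, h.1.2 \in S & h.2 == d h.1.2]].
  by rewrite mem_cat mem_cat mem_edges mem_star (mem_spokes s S d) orbA.
have hcells_mulT T H K : {in H, forall h, (h.1.1 \in s1 |: T) && (h.1.2 \in s1 |: T)} ->
    {in K, forall h, (h.1.1 \notin s1 |: T) && (h.1.2 \notin s1 |: T)} ->
    (hcells setT H * hcells setT K = hcells (@setT (V -> R)) (H ++ K))%N.
  move=> HT KT; rewrite -[in RHS](setIT setT).
  by rewrite (@hcells_mul _ _ (mem (s1 |: T)%SET)).
have TSb T v : T \subset S -> (v \in T) ==> (v \in S).
  by move=> TS; apply/implyP/(fintype.subsetP TS).
have sSb s v : s \notin S -> (v == s) ==> (v \notin S).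
  by move=> sS; apply/implyP => /eqP->.
have s12b v : ~~ ((v == s1) && (v == s2)).
  by apply/negP => /andP[/eqP-> s12']; rewrite s12' in s12.
have inside T D' : {in edges T ++ star s1 D' T, forall h,
    (h.1.1 \in s1 |: T) && (h.1.2 \in s1 |: T)}.
  move=> h; rewrite mem_cat mem_edges mem_star !finset.in_setU1.
  by case/orP => [/and4P[-> -> _ _]|/and3P[-> -> _]]; rewrite !orbT.
have outside T v : (v \in (S :\: T)%SET) || (v == s2) -> T \subset S ->
    v \notin s1 |: T.
  move=> + TS; rewrite finset.in_setU1 finset.in_setD.
  move: (TSb T v TS) (sSb s1 v s1S) (sSb s2 v s2S) (s12b v).
  by case: (v == s1); case: (v == s2); case: (v \in T); case: (v \in S).
have lhs T : T \subset S ->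
    (ncells_star s1 (d :: D) T * ncells_edges (S :\: T)%SET =
    hcells setT [seq h <- L s1 | uncut s1 T h])%N.
  move=> TS; rewrite /ncells_star /ncells_edges (@hcells_mulT T).
  - apply: hcells_eqi => -[[u v] g].
    rewrite mem_filter memL !mem_cat !mem_edges mem_star mem_spokes /uncut /=.
    rewrite !finset.in_setU1 !finset.in_setD.
    move: (TSb T u TS) (TSb T v TS) (sSb s1 u s1S) (sSb s1 v s1S).
    case: (u == s1); case: (v == s1); case: (u \in T); case: (u \in S) => //;
    case: (v \in T); case: (v \in S); rewrite //= ?orbF ?andbF //= => _ _ _ _.
    by rewrite orbC.
  - exact: inside.
  - move=> h; rewrite mem_edges => /and4P[h1 h2 _ _].
    by rewrite !outside // ?h1 ?h2.
have rhs T : T \subset S ->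
    (ncells_star s1 D T * ncells_star s2 [:: d] (S :\: T)%SET =
    hcells setT [seq h <- L s2 | uncut s1 T h])%N.
  move=> TS; rewrite /ncells_star (@hcells_mulT T).
  - apply: hcells_eqi => -[[u v] g].
    rewrite mem_filter memL !mem_cat !mem_edges mem_star mem_spokes in_nil /uncut /=.
    rewrite !finset.in_setU1 !finset.in_setD !orbF.
    move: (TSb T u TS) (TSb T v TS) (sSb s1 u s1S) (sSb s1 v s1S).
    move: (sSb s2 u s2S) (sSb s2 v s2S) (s12b u) (s12b v).
    case: (u == s1); case: (v == s1); case: (u == s2); case: (v == s2) => //;
    case: (u \in T); case: (u \in S) => //;
    case: (v \in T); case: (v \in S); rewrite //= ?orbF ?andbF //= => _ _ _ _ _ _ _ _.
  - exact: inside.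
  - move=> h; rewrite mem_cat mem_edges mem_star.
    by case/orP => [/and4P[h1 h2 _ _]|/and3P[h1 h2 _]]; rewrite !outside // ?h1 ?h2 ?orbT.
rewrite (eq_bigr _ lhs) (eq_bigr _ rhs).
have expand s : (\sum_(T : {set V} | T \subset S)
      hcells setT [seq h <- L s | uncut s1 T h])%N%:Z =
    \sum_(B <- sublists (edges S ++ star s1 D S)) \sum_(C <- sublists (enum S))
    let BC := B ++ [seq (s, v, d v) | v <- C] in
    \sum_(T : {set V} | (T \subset S) && all (uncut s1 T) BC) weight setT BC.
  rewrite (big_morph _ PoszD (erefl : 0%N%:Z = 0)).
  under eq_bigr => T _ do rewrite whitney // big_sublists_filter big_mkcond.
  rewrite exchange_big /= big_sublists_cat; apply: eq_bigr => B _.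
  rewrite big_sublists_map; apply: eq_bigr => C _.
  by rewrite -big_mkcondr.
apply/eqP; rewrite -eqz_nat !expand; apply/eqP.
apply: eq_big_seq => B /sublists_subset BS; apply: eq_big_seq => C /sublists_subset CS.
by apply: uncut_weight => // v /CS; rewrite mem_enum.
Qed.

End Stars.

Lemma big_sublists_set (A : nmodType) (V : finType) (l : seq V)
    (f : {set V} -> A) : uniq l ->
  \sum_(C <- sublists l) f [set v in C]%SET =
  \sum_(N : {set V} | N \subset [set v in l]%SET) f N.
Proof.
elim: l f => [|x l IHl] f /=.
  move=> _; rewrite big_seq1 (big_pred1 [set v in [::]]%SET) // => N.
  by rewrite (_ : [set v in [::]]%SET = finset.set0) ?finset.subset0.
case/andP => xl ul; rewrite big_cat big_map /= IHl //.
rewrite [RHS](bigID (fun N : {set V} => x \in N)) /= addrC; congr (_ + _).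
  have consE C : [set v in x :: C]%SET = x |: [set v in C]%SET.
    by apply/setP => v; rewrite !inE.
  under eq_bigr => C _ do rewrite consE.
  rewrite (IHl (fun C => f (x |: C)%SET)) //.
  rewrite [RHS](reindex_onto (fun N => x |: N)%SET (fun N => N :\ x)%SET); last first.
    by move=> N /andP[_ xN]; rewrite finset.setD1K.
  apply: eq_bigl => N; apply/idP/idP.
    move=> Nl; rewrite finset.setU11 andbT; apply/andP; split; last first.
      apply/eqP; rewrite finset.setU1K //; apply: contra xl => /(fintype.subsetP Nl).
      by rewrite inE.
    apply/fintype.subsetP => v; rewrite !inE => /orP[->//|/(fintype.subsetP Nl)].
    by rewrite inE => ->; rewrite orbT.
  move=> /andP[/andP[/fintype.subsetP Nl _] /eqP xN].
  apply/fintype.subsetP => v; rewrite -xN !inE => /andP[/negbTE vx].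
  rewrite vx /= => vN.
  by have := Nl v; rewrite !inE vx vN => /(_ isT).
apply: eq_bigl => N; apply/fintype.subsetP/andP.
  move=> Nl; split; last by apply: contra xl => /Nl; rewrite inE.
  by apply/fintype.subsetP => v /Nl; rewrite !inE => ->; rewrite orbT.
move=> [/fintype.subsetP Nl xN] v vN; have := Nl v vN; rewrite !inE.
by case: eqP => // vx; rewrite vx (negbTE xN) in vN.
Qed.

Section StarIdentities.
Variables (R : realType) (V : finType) (a : V -> R).
Implicit Types (S T U N : {set V}) (s v : V) (d : V -> R) (D : seq (V -> R)).

Lemma ncells_star_shift S s1 s2 g : s1 \notin S -> s2 \notin S ->
  ncells_star a s1 [:: fun=> g] S = ncells_star a s2 [:: fun=> 0] S.
Proof.
move=> s1S s2S.
pose rho (x y : V -> R) := {in S, x =1 y} /\ x s1 - g = y s2.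
apply: (@hcells_transfer _ _ _ _ _ rho).
- move=> x _; exists (fun v => if v == s2 then x s1 - g else x v) => //.
  by split=> [v vS|]; rewrite ?eqxx // (neq_notin s2S vS).
- move=> y _; exists (fun v => if v == s1 then y s2 + g else y v) => //.
  by split=> [v vS|]; rewrite ?eqxx ?addrK // (neq_notin s1S vS).
- move=> [[u v] e]; rewrite mem_cat mem_edges mem_star /= orbF.
  case/orP => [/and4P[uS vS uv ea]|/and3P[/eqP-> vS /eqP->]]; left.
    exists (u, v, e), 1; rewrite oner_eq0; split=> //.
      by rewrite mem_cat mem_edges /= uS vS uv ea.
    by move=> x y [xy _]; rewrite /hyp /= !xy // mul1r.
  exists (s2, v, 0), 1; rewrite oner_eq0; split=> //.
    by rewrite mem_cat mem_star /= vS !eqxx orbT.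
  by move=> x y [xy xs]; rewrite /hyp /= (xy v) // -xs; ring.
move=> [[u v] e]; rewrite mem_cat mem_edges mem_star /= orbF.
case/orP => [/and4P[uS vS uv ea]|/and3P[/eqP-> vS /eqP->]].
  exists (u, v, e), 1; rewrite oner_eq0; split=> //.
    by rewrite mem_cat mem_edges /= uS vS uv ea.
  by move=> x y [xy _]; rewrite /hyp /= !xy // mul1r.
exists (s1, v, g), 1; rewrite oner_eq0; split=> //.
  by rewrite mem_cat mem_star /= vS !eqxx orbT.
by move=> x y [xy xs]; rewrite /hyp /= (xy v) // -xs; ring.
Qed.

(* Reflecting every interval [x v - a v, x v] exchanges its two ends. *)
Lemma ncells_star_reflect S s : s \notin S ->
  ncells_star a s [:: fun v => - a v] S = ncells_star a s [:: fun=> 0] S.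
Proof.
move=> sS.
pose refl (x : V -> R) v := if v \in S then a v - x v else - x v.
have reflK x : refl (refl x) = x.
  by apply/funext => v; rewrite /refl; case: (v \in S); ring.
apply: (@hcells_transfer _ _ _ _ _ (fun x y => y = refl x)).
- by move=> x _; exists (refl x).
- by move=> y _; exists (refl y).
- move=> [[u v] e]; rewrite mem_cat mem_edges mem_star /= orbF.
  case/orP => [/and4P[uS vS uv /eqP->]|/and3P[/eqP-> vS /eqP->]]; left.
    exists (v, u, a v), 1; rewrite oner_eq0; split=> //.
      by rewrite mem_cat mem_edges /= uS vS eq_sym uv eqxx.
    by move=> x _ ->; rewrite /hyp /refl /= uS vS; ring.
  exists (s, v, 0), (-1); rewrite oppr_eq0 oner_eq0; split=> //.
    by rewrite mem_cat mem_star /= vS !eqxx orbT.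
  by move=> x _ ->; rewrite /hyp /refl /= vS (negbTE sS); ring.
move=> [[u v] e]; rewrite mem_cat mem_edges mem_star /= orbF.
case/orP => [/and4P[uS vS uv /eqP->]|/and3P[/eqP-> vS /eqP->]].
  exists (v, u, a v), 1; rewrite oner_eq0; split=> //.
    by rewrite mem_cat mem_edges /= uS vS eq_sym uv eqxx.
  by move=> x _ ->; rewrite /hyp /refl /= uS vS; ring.
exists (s, v, - a v), (-1); rewrite oppr_eq0 oner_eq0; split=> //.
  by rewrite mem_cat mem_star /= vS !eqxx orbT.
by move=> x _ ->; rewrite /hyp /refl /= vS (negbTE sS); ring.
Qed.

Lemma ncells_edgesU1 S b : b \notin S ->
  ncells_edges a (b |: S) = ncells_star a b [:: fun=> a b; fun v => - a v] S.
Proof.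
move=> bS; apply: (@hcells_transfer _ _ _ _ _ eq).
- by move=> x _; exists x.
- by move=> x _; exists x.
- move=> [[u v] e]; rewrite mem_edges /= !inE.
  case/and4P => /predU1P[->|uS] /predU1P[->|vS]; rewrite ?eqxx // => uv /eqP->; left.
  + exists (b, v, a b), 1; rewrite oner_eq0; split=> // [|x _ <-]; last by rewrite mul1r.
    by rewrite mem_cat mem_star /= vS !eqxx orbT.
  + exists (b, u, - a u), (-1); rewrite oppr_eq0 oner_eq0; split=> //.
      by rewrite mem_cat mem_star /= uS !eqxx !orbT.
    by move=> x _ <-; rewrite /hyp /=; ring.
  + exists (u, v, a u), 1; rewrite oner_eq0; split=> // [|x _ <-]; last by rewrite mul1r.
    by rewrite mem_cat mem_edges /= uS vS uv eqxx.
move=> [[u v] e]; rewrite mem_cat mem_edges mem_star /= orbF.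
case/orP => [/and4P[uS vS uv /eqP->]|/and3P[/eqP-> vS /orP[]/eqP->]].
- exists (u, v, a u), 1; rewrite oner_eq0; split=> // [|x _ <-]; last by rewrite mul1r.
  by rewrite mem_edges /= !inE uS vS uv eqxx !orbT.
- exists (b, v, a b), 1; rewrite oner_eq0; split=> // [|x _ <-]; last by rewrite mul1r.
  by rewrite mem_edges /= !inE vS !eqxx orbT /= eq_sym (neq_notin bS vS).
- exists (v, b, a v), (-1); rewrite oppr_eq0 oner_eq0; split=> //.
    by rewrite mem_edges /= !inE vS !eqxx orbT /= (neq_notin bS vS).
  by move=> x _ <-; rewrite /hyp /=; ring.
Qed.

Lemma hcells_spokes s (l : seq V) (H : seq (V * V * R)) F :
  affine_set F -> s \notin l -> uniq l ->
  (forall x y, (forall v, v \notin l -> x v = y v) -> F x -> F y) ->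
  (hcells F ([seq (s, v, 0%R) | v <- l] ++ H) =
  \sum_(C <- sublists l) hcells (F `&` [set x | {in C, forall v, x v = x s}]) H)%N.
Proof.
elim: l F => [|u l IHl] F Faff /=.
  move=> _ _ _; rewrite big_seq1; congr hcells.
  by apply/seteqP; split=> [x Fx|x []].
rewrite inE negb_or => /andP[su sl] /andP[ul uniql] Fl.
have [[x0 Fx0]|F0] := pselect (F !=set0); last first.
  have {}F0 : F = set0 by rewrite -subset0 => x Fx; apply: F0; exists x.
  rewrite F0 hcells_set0 big1 // => C _; rewrite set0I.
  by rewrite hcells_set0.
rewrite hcells_deletion //; last first.
  pose y v := if v == u then x0 s + 1 else x0 v.
  have Fy : F y.
    apply: (Fl x0) => // v; rewrite inE negb_or => /andP[/negbTE vu _].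
    by rewrite /y vu.
  move=> /(_ y Fy); rewrite /hyp /= /y eqxx (negbTE su) => /eqP.
  by rewrite subr0 opprD addrA subrr add0r oppr_eq0 oner_eq0.
rewrite IHl // ?IHl //.
- rewrite big_cat /= big_map; congr addn; apply: eq_bigr => C _; congr hcells.
  rewrite -setIA; congr (_ `&` _); apply/seteqP; split=> x /=.
    move=> [xu xC] v; rewrite inE => /orP[/eqP->|/xC//].
    by apply/esym/eqP; rewrite -subr_eq0 -[X in X == _]subr0; apply/eqP.
  move=> xC; split; last by move=> v vC; apply: xC; rewrite inE vC orbT.
  by rewrite /hyp /= (xC u) ?mem_head // subrr subr0.
- exact: affine_setI.
- move=> x y xy [Fx /= hx]; split.
    by apply: (Fl x) => // v; rewrite inE negb_or => /andP[_ /xy].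
  by rewrite /hyp /= -!xy.
- move=> x y xy; apply: Fl => v; rewrite inE negb_or => /andP[_ /xy].
  exact.
Qed.

Hypothesis a_neq0 : forall v, a v != 0.

Lemma hcells_merge S N s : s \notin S -> N \subset S -> N != finset.set0 ->
  hcells [set x | {in N, forall v, x v = x s}] (edges a S) =
  ncells_star a s ([seq (fun=> a j) | j <- enum N] ++ [:: fun v => - a v]) (S :\: N).
Proof.
move=> sS NS /set0Pn[j0 j0N].
pose rho (x y : V -> R) :=
  [/\ {in N, forall v, x v = x s}, x s = y s & {in S :\: N, x =1 y}].
have sN : s \notin N by apply: contra sS => /(fintype.subsetP NS).
apply: (@hcells_transfer _ _ _ _ _ rho).
- by move=> x xN; exists x.
- move=> y _; exists (fun v => if v \in N then y s else y v).
    by move=> v vN /=; rewrite vN (negbTE sN).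
  split=> [v vN||v]; rewrite ?vN ?(negbTE sN) //.
  by rewrite finset.in_setD => /andP[/negbTE->].
- move=> [[u v] e]; rewrite mem_edges /= => /and4P[uS vS uv /eqP->].
  have [uN|uN] := boolP (u \in N); have [vN|vN] := boolP (v \in N).
  + right; exists (- a u); first by rewrite oppr_eq0.
    by move=> x y [xN _ _]; rewrite /hyp /= !xN // subrr sub0r.
  + left; exists (s, v, a u), 1; rewrite oner_eq0; split=> //.
      rewrite mem_cat mem_star /= eqxx finset.in_setD vS vN has_cat has_map.
      apply/orP; right; apply/orP; left; apply/hasP; exists u => //=.
      by rewrite mem_enum.
    move=> x y [xN xs xy]; rewrite /hyp /= xN // xs xy ?mul1r //.
    by rewrite finset.in_setD vS vN.
  + left; exists (s, u, - a u), (-1); rewrite oppr_eq0 oner_eq0; split=> //.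
      by rewrite mem_cat mem_star /= eqxx finset.in_setD uS uN has_cat /= eqxx !orbT.
    move=> x y [xN xs xy]; rewrite /hyp /= (xN v) // xs xy; first by ring.
    by rewrite finset.in_setD uS uN.
  + left; exists (u, v, a u), 1; rewrite oner_eq0; split=> //.
      by rewrite mem_cat mem_edges /= !finset.in_setD uS vS uN vN uv eqxx.
    by move=> x y [_ _ xy]; rewrite /hyp /= !xy ?mul1r // finset.in_setD ?uS ?uN ?vS ?vN.
move=> [[u v] e]; rewrite mem_cat mem_edges mem_star /= !finset.in_setD.
case/orP => [/and4P[/andP[uN uS] /andP[vN vS] uv /eqP->]|].
  exists (u, v, a u), 1; rewrite oner_eq0; split=> //.
    by rewrite mem_edges /= uS vS uv eqxx.
  by move=> x y [_ _ xy]; rewrite /hyp /= !xy ?mul1r // finset.in_setD ?uS ?uN ?vS ?vN.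
case/and3P => /eqP-> /andP[vN vS]; rewrite has_cat has_map /= orbF.
have xyv x y : rho x y -> x v = y v.
  by move=> [_ _]; apply; rewrite finset.in_setD vN vS.
case/orP => [/hasP[j jN /= /eqP->]|/eqP->].
  rewrite mem_enum in jN.
  exists (j, v, a j), 1; rewrite oner_eq0; split=> //.
    by rewrite mem_edges /= (fintype.subsetP NS) // vS eqxx (contraNneq _ vN) // => <-.
  by move=> x y xy; rewrite /hyp /= (xyv x y) //; case: xy => [xN xs _]; rewrite xN // xs mul1r.
exists (v, j0, a v), (-1); rewrite oppr_eq0 oner_eq0; split=> //.
  by rewrite mem_edges /= (fintype.subsetP NS _ j0N) vS eqxx (contraNneq _ vN) // => ->.
by move=> x y xy; rewrite /hyp /= (xyv x y) //; case: xy => [xN xs _]; rewrite xN // xs; ring.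
Qed.

Lemma ncells_star_expand S s : s \notin S ->
  (ncells_star a s [:: fun=> 0%R] S = ncells_edges a S +
   \sum_(N : {set V} | (N \subset S) && (N != finset.set0)) ncells_star a s
      ([seq (fun=> a j) | j <- enum N] ++ [:: fun v => (- a v)%R]) (S :\: N)%SET)%N.
Proof.
move=> sS; rewrite /ncells_star /star /= cats0 /hcells map_cat ncells_catC -map_cat.
rewrite -/(hcells _ _) hcells_spokes ?enum_uniq ?mem_enum //.
rewrite (eq_bigr (fun C => hcells [set x | {in [set v in C]%SET, forall v, x v = x s}]
  (edges a S))); last first.
  move=> C _; congr hcells; rewrite setTI; apply/seteqP.
  by split=> x xC v; [rewrite inE|move=> vC]; apply: xC; rewrite ?inE.
rewrite (big_sublists_set (fun N => hcells [set x | {in N, forall v, x v = x s}] _))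
  ?enum_uniq //.
rewrite (_ : [set v in enum S]%SET = S); last by apply/setP => v; rewrite inE mem_enum.
rewrite (bigD1 finset.set0) /=; last by rewrite finset.sub0set.
congr addn.
  congr hcells; apply/seteqP; split=> x // _ v; rewrite inE //.
by apply: eq_bigr => N /andP[NS N0]; rewrite hcells_merge.
Qed.
End StarIdentities.

(** * Genericity *)

Section Genericity.
Variables (R : realType) (V : finType) (a : V -> R).
Implicit Types (S : {set V}) (c : V -> int).

Lemma sum_shift_coef c (e : int) v :
  \sum_i (c i + e *+ (i == v))%:~R * a i = \sum_i (c i)%:~R * a i + e%:~R * a v.
Proof.
under eq_bigr => i _ do rewrite rmorphD mulrDl.
rewrite big_split /=; congr (_ + _).
rewrite (bigD1 v) //= eqxx mulr1n big1 ?addr0 // => i /negbTE ->.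
by rewrite mulr0n mul0r.
Qed.

(* An inner vertex of the path contributes [a] at most twice, with opposite
   signs: once for each of its edges of which it is the tail. *)
Lemma tight_path_sum S x u p :
  u \in S -> path (tight a S x) u p -> uniq (u :: p) ->
  exists c, [/\ forall i, c i \in [:: -1; 0; 1],
    forall i, i \notin S -> c i = 0, c u \in [:: 0; 1],
    c (last u p) \in [:: 0; -1] &
    x u - x (last u p) = \sum_i (c i)%:~R * a i].
Proof.
suff H : u \in S -> path (tight a S x) u p -> uniq (u :: p) ->
  exists c, [/\ [/\ forall i, c i \in [:: -1; 0; 1],
    forall i, i \notin S -> c i = 0, c u \in [:: 0; 1],
    c (last u p) \in [:: 0; -1] &
    x u - x (last u p) = \sum_i (c i)%:~R * a i] &
    forall i, i \notin u :: p -> c i = 0].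
  by move=> uS pp up; have [c [? _]] := H uS pp up; exists c.
elim: p u => [|v p IHp] u uS /=.
  move=> _ _; exists (fun=> 0); split=> //; split=> //.
  by rewrite subrr big1 // => i _; rewrite mul0r.
case/andP => uv vp /andP[up vpu].
have /and3P[_ vS uv'] := uv.
have [c [[c1 cS cv cl sumc] cp]] := IHp v vS vp vpu.
have cu : c u = 0 by apply: cp.
have uneqv : u != v by move: up; rewrite inE negb_or => /andP[].
have lu : last v p != u by apply: contraNneq up => <-; apply: mem_last.
case/orP: uv' => /eqP xuv.
  exists (fun i => c i + 1 *+ (i == u)); split; first split.
  - by move=> i; case: eqVneq => [->|_]; rewrite ?cu ?mulr0n ?addr0.
  - move=> i iS; rewrite cS // (_ : (i == u) = false) //.
    by apply: contraNF iS => /eqP->.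
  - by rewrite eqxx cu.
  - by rewrite (negbTE lu) mulr0n addr0.
  - by rewrite sum_shift_coef -sumc mul1r -xuv; ring.
  - move=> i; rewrite inE negb_or => /andP[/negbTE-> ip].
    by rewrite mulr0n addr0 cp.
exists (fun i => c i + -1 *+ (i == v)); split; first split.
- move=> i; case: eqVneq => [->|_]; rewrite ?mulr0n ?addr0 // mulr1n.
  by move: cv; rewrite !inE => /orP[]/eqP->.
- move=> i iS; rewrite cS // (_ : (i == v) = false) //.
  by apply: contraNF iS => /eqP->.
- by rewrite (negbTE uneqv) mulr0n addr0 cu.
- have [lv|lv] := eqVneq (last v p) v; last by rewrite mulr0n addr0.
  rewrite lv in cl; rewrite lv.
  have -> : c v = 0 by move: cv cl; rewrite !inE => /orP[]/eqP->.
  by [].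
- by rewrite sum_shift_coef -sumc mulN1r -xuv; ring.
- move=> i; rewrite !inE !negb_or => /andP[_ /andP[iv ip]].
  by rewrite (negbTE iv) mulr0n addr0 cp // inE negb_or iv.
Qed.

Hypothesis a_generic : forall c, (forall i, c i \in [:: -1; 0; 1]) ->
  \sum_i (c i)%:~R * a i = 0 -> forall i, c i = 0.

Lemma generic_neq0 v : a v != 0.
Proof.
apply/eqP => av.
have /(_ v) : forall i, 0 + 1 *+ (i == v) = 0 :> int.
  apply: a_generic => [i|]; first by case: (i == v).
  by rewrite sum_shift_coef big1 ?av ?mulr0 ?addr0 // => i _; rewrite mul0r.
by rewrite eqxx.
Qed.

Lemma generic_cross S b (l : seq V) x u v :
  b \notin S -> b \notin l -> {in l, forall j, j \notin S} ->
  {in [seq (fun=> a j) | j <- l] ++ [:: fun v => - a v], forall d',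
    u \in S -> v \in S -> connect (tight a S x) u v -> x u + a b != x v + d' v}.
Proof.
move=> bS bl lS d' d'l uS vS /connectP[p0 /shortenP[p up uniqp _] vlast].
have [c [c1 cS cu cl sumc]] := tight_path_sum uS up uniqp.
rewrite -vlast in cl sumc; apply/eqP => eqb.
have cb : c b = 0 by apply: cS.
have vb : (v == b) = false by apply: contraNF bS => /eqP<-.
move: d'l; rewrite mem_cat inE => /orP[/mapP[j jl d'E]|/eqP d'E].
  have bj : (b == j) = false by apply: contraNF bl => /eqP->.
  have /(_ b) : forall i, (c i + 1 *+ (i == b)) + -1 *+ (i == j) = 0.
    apply: a_generic => [i|].
      case: (eqVneq i b) => [->|_]; first by rewrite cb bj.
      case: (eqVneq i j) => [->|_]; first by rewrite cS ?lS.
      by rewrite !mulr0n !addr0.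
    rewrite !sum_shift_coef -sumc.
    by move: eqb; rewrite d'E; lra.
  by rewrite eqxx bj cb.
have /(_ b) : forall i, (c i + 1 *+ (i == b)) + 1 *+ (i == v) = 0.
  apply: a_generic => [i|].
    case: (eqVneq i b) => [->|_]; first by rewrite cb eq_sym vb.
    case: (eqVneq i v) => [->|_]; last by rewrite !mulr0n !addr0.
    by move: cl; rewrite !inE => /orP[]/eqP->.
  rewrite !sum_shift_coef -sumc.
  by move: eqb; rewrite d'E; lra.
by rewrite eqxx cb eq_sym vb.
Qed.
End Genericity.

(** * Formal power series *)

Section PowerSeries.
Variable K : fieldType.
Implicit Types (f g h : fps K).

Definition eq_upto n f g := forall m, (m < n)%N -> fps_coef f m = fps_coef g m.

Lemma eq_uptoM n f f' g g' :
  eq_upto n f f' -> eq_upto n g g' -> eq_upto n (f * g) (f' * g').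
Proof.
move=> ff gg m mn; rewrite !fps_coefM; apply: eq_bigr => i _.
by rewrite ff ?gg // (leq_ltn_trans _ mn) ?leq_subr // -ltnS.
Qed.

Lemma eq_uptoX n f f' k : eq_upto n f f' -> eq_upto n (f ^+ k) (f' ^+ k).
Proof. by move=> ff; elim: k => // k IHk; rewrite !exprS; apply: eq_uptoM. Qed.

Lemma fps_fixpoint (Phi : fps K -> fps K) :
  (forall n f g, eq_upto n f g -> eq_upto n.+1 (Phi f) (Phi g)) ->
  exists y, forall f, Phi f = f <-> f = y.
Proof.
move=> causal; pose u n := iter n Phi 0.
have u_stable n k : eq_upto n (u n) (u (n + k)%N).
  by elim: n => // n IHn; apply: causal.
pose y : fps K := FPS (fun n => fps_coef (u n.+1) n).
have uy n : eq_upto n (u n) y.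
  by move=> m mn; rewrite -(subnKC mn) [RHS](u_stable m.+1 (n - m.+1)%N).
exists y => f; split=> [fE|->].
  apply: fpsP => n; have : eq_upto n.+1 f y; last exact.
  elim: n.+1 => // {}n IHn m mn.
  by rewrite -fE -(uy n.+1) //; apply: (causal n) => // k kn; rewrite IHn // uy.
by apply: fpsP => n; rewrite -(uy n.+1) //; apply: (causal n) => // m mn; rewrite uy.
Qed.

Lemma fps_coefXM f n : fps_coef (fpsX * f) n = if n is m.+1 then fps_coef f m else 0.
Proof.
case: n => [|n]; rewrite fps_coefM big_ord_recl /= ?big_ord0 mul0r ?addr0 //.
rewrite big_ord_recl /= mul1r subn1 /= add0r big1 ?addr0 // => i _.
by rewrite mul0r.
Qed.

Lemma fps_coefXnM f k n :
  fps_coef (fpsX ^+ k * f) n = if (k <= n)%N then fps_coef f (n - k) else 0.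
Proof.
elim: k n => [|k IHk] n; first by rewrite mul1r subn0.
by rewrite exprS -mulrA fps_coefXM; case: n => // n; rewrite IHk ltnS subSS.
Qed.

Lemma fps_coef_expM f h n : fps_coef (fps_exp (fpsX * f) * h) n =
  \sum_(k < n.+1) (k`!)%:R^-1 * fps_coef (f ^+ k * h) (n - k).
Proof.
have expE m : (m <= n)%N -> fps_coef (fps_exp (fpsX * f)) m =
    \sum_(k < n.+1) (k`!)%:R^-1 * fps_coef ((fpsX * f) ^+ k) m.
  move=> mn; rewrite /= (big_ord_widen n.+1
    (fun k => (k`!)%:R^-1 * fps_coef ((fpsX * f) ^+ k) m)) //.
  rewrite big_mkcond /=; apply: eq_bigr => k _; case: ifPn => //.
  rewrite -leqNgt => mk; rewrite fps_coefX_small ?mulr0 //.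
  by rewrite fps_coefXM.
rewrite fps_coefM.
under eq_bigr => i _ do rewrite expE -1?ltnS // big_distrl /=.
rewrite exchange_big; apply: eq_bigr => k _.
have <- : fps_coef ((fpsX * f) ^+ k * h) n = fps_coef (f ^+ k * h) (n - k).
  by rewrite exprMn -mulrA fps_coefXnM -ltnS ltn_ord.
rewrite fps_coefM big_distrr /=; apply: eq_bigr => i _.
by rewrite mulrA.
Qed.

Lemma functional_eq_fixpoint f :
  1 = f * (2 - fps_exp (fpsX * f)) <-> 1 + (fps_exp (fpsX * f) * f - f) = f.
Proof.
set e := fps_exp _; split=> E; first by rewrite {1}E; ring.
have -> : f * (2 - e) = f - (e * f - f) by ring.
by rewrite -{1}E addrK.
Qed.

Lemma fps_coef_fixpoint f n :
  fps_coef (1 + (fps_exp (fpsX * f) * f - f)) n =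
  (n == 0)%:R + \sum_(k < n) (k.+1`!)%:R^-1 * fps_coef (f ^+ k.+2) (n - k.+1).
Proof.
rewrite fps_coefD fps_coef1 fps_coefD fps_coefN fps_coef_expM big_ord_recl.
rewrite [X in X + _ - _](_ : _ = fps_coef f n); last first.
  by rewrite fact0 invr1 mul1r expr0 mul1r subn0.
rewrite addrAC subrr add0r; congr (_ + _).
by apply: eq_bigr => k _; rewrite exprSr.
Qed.

Lemma functional_eq_solution :
  exists y : fps K, forall f, 1 = f * (2 - fps_exp (fpsX * f)) <-> f = y.
Proof.
have [n f g fg|y Hy] := @fps_fixpoint (fun f => 1 + (fps_exp (fpsX * f) * f - f)).
  move=> m; rewrite ltnS => mn; rewrite !fps_coef_fixpoint; congr (_ + _).
  apply: eq_bigr => k _; congr (_ * _); apply: (@eq_uptoX _ _ _ k.+2 fg).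
  by apply: leq_trans mn; rewrite ltn_subrL /= (leq_ltn_trans _ (ltn_ord k)).
by exists y => f; rewrite functional_eq_fixpoint; apply: Hy.
Qed.
End PowerSeries.

Section LogDerivative.
Variable K : numFieldType.
Implicit Types (f g h : fps K).

Lemma log_deriv_eq g h : fps_coef h 0 = 1 ->
  fps_deriv h / h = g <-> fps_deriv h = g * h.
Proof.
move=> h0; have hU : h \is a GRing.unit by rewrite fps_unitE h0 oner_neq0.
by split=> [<-|->]; rewrite ?divrK ?mulrK.
Qed.

Lemma log_deriv_solution g : exists z : fps K, forall f,
  (fps_deriv f / f = g /\ fps_coef f 0 = 1) <-> f = z.
Proof.
pose Phi f : fps K :=
  FPS (fun n => if n is m.+1 then fps_coef (g * f) m / n%:R else 1).
have [n f f' ff|z Hz] := @fps_fixpoint K Phi.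
  case=> // m; rewrite ltnS => mn /=; congr (_ / _).
  by apply: (@eq_uptoM _ n g g).
exists z => f; rewrite -Hz; split=> [[fE f0]|fE].
  move/(log_deriv_eq _ f0): fE => fE; apply: fpsP => -[|n] //.
  transitivity (fps_coef (fps_deriv f) n / n.+1%:R); first by rewrite fE.
  by rewrite /= -[fps_coef f _ *+ _]mulr_natr mulfK // pnatr_eq0.
have f0 : fps_coef f 0 = 1 by rewrite -fE.
split=> //; apply/(log_deriv_eq _ f0); apply: fpsP => n.
transitivity (fps_coef (Phi f) n.+1 *+ n.+1); first by rewrite fE.
by rewrite -[LHS]mulr_natr mulfVK // pnatr_eq0.
Qed.
End LogDerivative.

(** * Counting cells *)

Section SubsetConvolution.
Variables (K : numFieldType) (V : finType).
Implicit Types (f g h z : fps K) (S T : {set V}).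

Definition egf_coef f n : K := (n`!)%:R * fps_coef f n.

Lemma sum_subset_card S (F : nat -> K) :
  \sum_(T : {set V} | T \subset S) F #|T| =
  \sum_(k < #|S|.+1) F k *+ 'C(#|S|, k).
Proof.
rewrite (partition_big (fun T : {set V} => inord #|T| : 'I_#|S|.+1) xpredT) //=.
apply: eq_bigr => k _; rewrite -cards_draws -sumr_const; apply: eq_big => T.
  rewrite inE; apply: andb_id2l => /subset_leq_card TS.
  by rewrite -val_eqE /= inordK.
move=> /andP[/subset_leq_card TS /eqP <-].
by rewrite inordK.
Qed.

Lemma subset_convolution f g S :
  \sum_(T : {set V} | T \subset S) egf_coef f #|T| * egf_coef g #|S :\: T| =
  egf_coef (f * g) #|S|.
Proof.
rewrite (eq_bigr (fun T : {set V} => egf_coef f #|T| * egf_coef g (#|S| - #|T|))); last first.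
  by move=> T TS; rewrite cardsDS.
rewrite (sum_subset_card S (fun k => egf_coef f k * egf_coef g (#|S| - k))).
rewrite /egf_coef fps_coefM big_distrr; apply: eq_bigr => k _.
rewrite -(bin_fact (ltn_ord k : k <= #|S|)%N) !natrM -[LHS]mulr_natr /=.
ring.
Qed.

Lemma subset_deconvolution (F : {set V} -> K) h z S :
  fps_coef z 0 = 1 ->
  (forall T, T \subset S ->
     \sum_(T' : {set V} | T' \subset T) F T' * egf_coef z #|T :\: T'| =
     egf_coef (h * z) #|T|) ->
  forall T, T \subset S -> F T = egf_coef h #|T|.
Proof.
move=> z0 Fconv T; have [n] := ubnP #|T|; elim: n T => // n IHn T.
rewrite ltnS => Tn TS; have := Fconv T TS.
rewrite -subset_convolution (bigD1 T) //= [in RHS](bigD1 T) //=.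
have -> : egf_coef z #|T :\: T| = 1.
  by rewrite finset.setDv finset.cards0 /egf_coef fact0 z0 mulr1.
rewrite !mulr1 (eq_bigr (fun T' : {set V} =>
  egf_coef h #|T'| * egf_coef z #|T :\: T'|)) => [/addIr//|T' /andP[T'T T'neq]].
congr (_ * _); apply: IHn; last exact: fintype.subset_trans TS.
by apply: leq_trans Tn; apply: proper_card; rewrite finset.properEneq T'neq.
Qed.
End SubsetConvolution.

Section Counting.
Variables (R : realType) (V : finType) (a : V -> R) (y z : fps R).
Implicit Types (S T N : {set V}) (s : V).
Hypothesis a_generic : forall c : V -> int, (forall i, c i \in [:: -1; 0; 1]) ->
  \sum_i (c i)%:~R * a i = 0 -> forall i, c i = 0.
Hypothesis yE : 1 + (fps_exp (fpsX * y) * y - y) = y.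
Hypothesis zE : fps_deriv z = y ^+ 2 * z.
Hypothesis z0 : fps_coef z 0 = 1.

Let E S := (ncells_edges a S)%:R : R.
Let W s D S := (ncells_star a s D S)%:R : R.
Let outs (l : seq V) := [seq (fun=> a j) | j <- l] ++ [:: fun v => - a v].

Lemma bundle_count S s s' (l : seq V) :
  s \notin S -> s' \notin S -> s != s' -> uniq l -> {in l, forall j, j \notin S} ->
  (forall T, T \subset S -> E T = egf_coef z #|T|) ->
  (forall t T, t \notin S -> T \subset S -> W t [:: fun=> 0] T = egf_coef (y * z) #|T|) ->
  forall T, T \subset S -> W s (outs l) T = egf_coef (y ^+ (size l).+1 * z) #|T|.
Proof.
move=> sS s'S ss' + + HE HW; elim: l => [|b l IHl] /=.
  move=> _ _ T TS; rewrite expr1 -(HW s) // /W ncells_star_reflect //.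
  by apply: contra sS => /(fintype.subsetP TS).
case/andP => bl ul blS; have bS : b \notin S by apply: blS; rewrite mem_head.
have lS : {in l, forall j, j \notin S} by move=> j jl; apply: blS; rewrite inE jl orbT.
have notinT t T : t \notin S -> T \subset S -> t \notin T.
  by move=> tS TS; apply: contra tS => /(fintype.subsetP TS).
apply: (@subset_deconvolution _ _ _ _ z) => // T TS.
transitivity (\sum_(T' : {set V} | T' \subset T)
    egf_coef (y ^+ (size l).+1 * z) #|T'| * egf_coef (y * z) #|T :\: T'|); last first.
  by rewrite subset_convolution; congr egf_coef; rewrite !exprS; ring.
have TD T' : (T :\: T' \subset S)%SET.
  by apply: fintype.subset_trans TS; rewrite finset.subsetDl.
transitivity ((\sum_(T' : {set V} | T' \subset T)
    ncells_star a s ((fun=> a b) :: outs l) T' * ncells_edges a (T :\: T')%SET)%N%:R : R).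
  rewrite natr_sum; apply: eq_bigr => T' T'T.
  by rewrite natrM -/(E _) HE.
rewrite (@star_cons_mul _ _ a T s s'); last first.
- move=> x u v d' d'l; apply: (generic_cross a_generic _ bl) => //.
    exact: notinT TS.
  by move=> j jl; apply: (notinT _ _ _ TS); apply: lS.
- exact: ss'.
- exact: notinT TS.
- exact: notinT TS.
rewrite natr_sum; apply: eq_bigr => T' T'T.
have T'S := fintype.subset_trans T'T TS.
rewrite natrM -/(W _ _ T') IHl //; congr (_ * _).
rewrite -(HW s') //; congr _%:R; apply: ncells_star_shift.
  by apply: contra s'S; rewrite inE => /andP[_ /(fintype.subsetP TS)].
by apply: contra s'S; rewrite inE => /andP[_ /(fintype.subsetP TS)].
Qed.

Lemma cell_count n S : #|S| = n ->
  (forall s, s \notin S -> W s [:: fun=> 0] S = egf_coef (y * z) n) /\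
  (forall s, s \notin S -> E S = egf_coef z n).
Proof.
elim/ltn_ind: n S => n IHn S Sn.
have HE T s : s \notin T -> (#|T| < n)%N -> E T = egf_coef z #|T|.
  by move=> sT Tn; have [_] := IHn _ Tn T erefl; apply; exact: sT.
have HW t T : t \notin T -> (#|T| < n)%N -> W t [:: fun=> 0] T = egf_coef (y * z) #|T|.
  by move=> tT Tn; have [+ _] := IHn _ Tn T erefl; apply.
have bundle S' s s' l : (#|S'| < n)%N -> s \notin S' -> s' \notin S' -> s != s' ->
    uniq l -> {in l, forall j, j \notin S'} ->
    W s (outs l) S' = egf_coef (y ^+ (size l).+1 * z) #|S'|.
  move=> S'n sS s'S ss' ul lS; apply: (bundle_count sS s'S ss' ul lS) => // [T TS|t T tS TS].
    apply: (HE T s); first by apply: contra sS => /(fintype.subsetP TS).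
    by apply: leq_ltn_trans S'n; apply: subset_leq_card.
  apply: HW; first by apply: contra tS => /(fintype.subsetP TS).
  by apply: leq_ltn_trans S'n; apply: subset_leq_card.
have ES s : s \notin S -> E S = egf_coef z n.
  have [S0|[b bS]] := set_0Vmem S.
    move=> _; rewrite -Sn S0 finset.cards0 /egf_coef z0 mulr1 fact0 /E.
    rewrite /ncells_edges /edges (_ : enum _ = [::]).
      rewrite /hcells /= ncells_nil asboolT //.
      by exists (fun=> 0).
    by apply/nilP; rewrite /nilp -cardE; apply/eqP/eq_card0 => p; rewrite !inE.
  move=> sS; have bS' : b \notin (S :\ b)%SET by rewrite !inE eqxx.
  have S'n : #|S :\ b|.+1 = n by rewrite -Sn (cardsD1 b S) bS.
  transitivity (W b (outs [:: b]) (S :\ b)%SET).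
    by rewrite /E -[in LHS](finset.setD1K bS) ncells_edgesU1.
  rewrite (bundle _ b s) -?S'n //.
  - rewrite /egf_coef -zE /= factS natrM -mulr_natr; ring.
  - by apply: contra sS; rewrite !inE => /andP[].
  - by apply: contraNneq sS => <-.
  - by move=> j; rewrite inE => /eqP->.
split=> // s sS; rewrite /W ncells_star_expand //; last exact: generic_neq0.
rewrite natrD -/(E S) (ES s) // natr_sum.
rewrite (eq_bigr (fun N : {set V} => egf_coef (y ^+ #|N|.+1 * z) (n - #|N|))); last first.
  move=> N /andP[NS N0]; have /set0Pn[j jN] := N0.
  have jS := fintype.subsetP NS j jN.
  rewrite -/(outs _) -/(W _ _ _) (bundle _ s j) ?enum_uniq //.
  - by rewrite -cardE cardsDS // Sn.
  - by rewrite cardsDS // Sn ltn_subrL card_gt0 N0 -Sn card_gt0; apply/set0Pn; exists j.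
  - by apply: contra sS; rewrite inE => /andP[].
  - by rewrite inE jN.
  - by apply: contraNneq sS => ->.
  - by move=> k; rewrite mem_enum inE => ->.
have tot : \sum_(N : {set V} | N \subset S) egf_coef (y ^+ #|N|.+1 * z) (n - #|N|) =
    egf_coef (fps_exp (fpsX * y) * (y * z)) n.
  rewrite (sum_subset_card S (fun k => egf_coef (y ^+ k.+1 * z) (n - k))) Sn.
  rewrite /egf_coef fps_coef_expM big_distrr; apply: eq_bigr => k _.
  rewrite -(bin_fact (ltn_ord k : k <= n)%N) !natrM -[LHS]mulr_natr.
  rewrite (_ : y ^+ k * (y * z) = y ^+ k.+1 * z); last by rewrite exprSr mulrA.
  have k0 : (k`!)%:R != 0 :> R by rewrite pnatr_eq0 -lt0n fact_gt0.
  by rewrite /=; field.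
rewrite (bigD1 finset.set0) ?finset.sub0set //= finset.cards0 subn0 expr1 in tot.
have : egf_coef (y * z) n = egf_coef z n + (egf_coef (fps_exp (fpsX * y) * (y * z)) n - egf_coef (y * z) n).
  rewrite /egf_coef -mulrBr -mulrDr -fps_coefN -!fps_coefD; congr (_ * fps_coef _ _).
  by rewrite -{1}yE; ring.
by rewrite -tot => ->; ring.
Qed.
End Counting.

(** * Regions are sign cells *)

Section CellsAsComponents.
Variables (R : realType) (X : normedModType R).
Implicit Types (F : set X) (h : X -> R) (L : seq (X -> R)).

Definition sign_cell F L x := F `&` [set y | same_signs L x y].

Lemma mem_cells F L C : C \in cells F L <->
  exists x, [/\ F x, {in L, forall h, h x != 0} & C = sign_cell F L x].
Proof.
elim: L F C => [|h L IHL] F C /=.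
  have cellT x : sign_cell F [::] x = F.
    by apply/seteqP; split=> [y []|y Fy].
  case: asboolP => F0; last by split=> // -[x [Fx]]; case: F0; exists x.
  rewrite inE; split=> [/eqP->|[x [_ _ ->]]]; last by rewrite cellT.
  by have [x Fx] := F0; exists x; rewrite cellT.
have cellP x : 0 < h x ->
    sign_cell (F `&` [set y | 0 < h y]) L x = sign_cell F (h :: L) x.
  move=> hx; apply/seteqP; split=> y.
    move=> [[Fy /= hy] xy]; split=> // g; rewrite inE => /orP[/eqP->|/xy//].
    by rewrite mulr_gt0.
  move=> [Fy xy]; split; last by move=> g gL; apply: xy; rewrite inE gL orbT.
  by split=> //=; have := xy h (mem_head _ _); rewrite pmulr_rgt0.
have cellN x : h x < 0 ->
    sign_cell (F `&` [set y | h y < 0]) L x = sign_cell F (h :: L) x.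
  move=> hx; apply/seteqP; split=> y.
    move=> [[Fy /= hy] xy]; split=> // g; rewrite inE => /orP[/eqP->|/xy//].
    by rewrite nmulr_rgt0.
  move=> [Fy xy]; split; last by move=> g gL; apply: xy; rewrite inE gL orbT.
  by split=> //=; have := xy h (mem_head _ _); rewrite nmulr_rgt0.
rewrite mem_cat; split.
  case/orP => /IHL[x [[Fx /= hx] xL ->]]; exists x.
    rewrite cellP //; split=> // g; rewrite inE => /orP[/eqP->|/xL//].
    by rewrite gt_eqF.
  rewrite cellN //; split=> // g; rewrite inE => /orP[/eqP->|/xL//].
  by rewrite lt_eqF.
move=> [x [Fx xL ->]].
have xL' : {in L, forall g, g x != 0} by move=> g gL; apply: xL; rewrite inE gL orbT.
case: (ltrgtP (h x) 0) (xL h (mem_head _ _)) => // hx _; apply/orP; [right|left].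
  by apply/IHL; exists x; rewrite cellN.
by apply/IHL; exists x; rewrite cellP.
Qed.

Lemma cells_uniq F L : uniq (cells F L).
Proof.
elim: L F => [|h L IHL] F /=; first by case: ifP.
rewrite cat_uniq !IHL andbT /=; apply/hasPn => C /mem_cells[x [[Fx /= hx] xL CE]].
apply/negP => /mem_cells[y [[Fy /= hy] yL]]; rewrite CE => xy.
have : sign_cell (F `&` [set x0 | h x0 < 0]) L x x.
  by split=> // g /xL g0; rewrite -expr2 exprn_even_gt0.
by rewrite xy => -[[_ /=]]; rewrite ltNge ltW.
Qed.

Lemma connected_component_cell F L x :
  (forall x y t, F x -> F y -> 0 <= t <= 1 -> F (x + t *: (y - x))) ->
  {in L, forall h, continuous h /\
     forall x y t, h (x + t *: (y - x)) = h x + t * (h y - h x)} ->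
  F x -> {in L, forall h, h x != 0} ->
  connected_component (F `&` [set y | {in L, forall h, h y != 0}]) x = sign_cell F L x.
Proof.
move=> Fconv Laff Fx xL; set U := F `&` _; apply/seteqP; split=> y.
  move=> [C [Cx CU Cconn] Cy]; split; first by have [] := CU y Cy.
  move=> h hL; have [hcont _] := Laff h hL.
  have Cint : is_interval (h @` C).
    apply/connected_intervalP/connected_continuous_connected => //.
    exact: continuous_subspaceT.
  have Cne z : C z -> h z != 0 by move=> /CU[_]; apply.
  have C0 : ~ (h @` C) 0 by move=> [z /Cne/eqP].
  case: (ltrgtP (h x) 0) (xL h hL) => // hx _.
    rewrite nmulr_rgt0 // ltNge; apply/negP => hy; apply: C0.
    by apply: (Cint (h x) (h y)); [exists x|exists y|rewrite (ltW hx)].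
  rewrite pmulr_rgt0 // ltNge; apply/negP => hy; apply: C0.
  by apply: (Cint (h y) (h x)); [exists y|exists x|rewrite hy ltW].
move=> [Fy xy]; pose path t := x + t *: (y - x).
exists (path @` `[0, 1]); last first.
  exists 1; first by rewrite /= in_itv /= ler01 lexx.
  by rewrite /path scale1r addrC subrK.
split.
- by exists 0; rewrite /= ?in_itv /= ?ler01 ?lexx // /path scale0r addr0.
- move=> _ [t /= + <-]; rewrite in_itv /= => t01; split; first exact: Fconv.
  move=> h hL; have [_ ->] := Laff h hL.
  have := xy h hL; case/andP: t01 => t0 t1 hxy; apply/eqP => h0.
  have : 0 < (h x + t * (h y - h x)) * h x.
    rewrite (_ : _ * _ = (1 - t) * h x ^+ 2 + t * (h x * h y)); last by ring.
    have [->|tn1] := eqVneq t 1; first by rewrite subrr mul0r add0r mul1r.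
    apply: ltr_pwDl; last by rewrite mulr_ge0 // ltW.
    apply: mulr_gt0; first by rewrite subr_gt0 lt_neqAle tn1.
    by rewrite exprn_even_gt0 //=; apply: xL.
  by rewrite h0 mul0r ltxx.
- apply: connected_continuous_connected; first exact: segment_connected.
  apply: continuous_subspaceT => t; apply: cvgD; first exact: cvg_cst.
  exact: scalel_continuous.
Qed.
End CellsAsComponents.

Section RegionsG.
Variables (R : realType) (a : nat -> R) (n : nat).

Let pairs := [seq p <- enum {: 'I_n.+1 * 'I_n.+1} | p.1 != p.2].
Let plane (p : 'I_n.+1 * 'I_n.+1) (x : 'rV[R]_n.+1) : R := x 0 p.1 - x 0 p.2 - a p.1.

Lemma regions_card :
  nb_regions_G a n.+1 = ncells (@sum0_space R n.+1) [seq plane p | p <- pairs].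
Proof.
set L := map _ _; set F := @sum0_space R n.+1.
rewrite /nb_regions_G /regions.
have -> : F `\` \bigcup_(H in arrangement_G a (n := n.+1)) H =
    F `&` [set x | {in L, forall h, h x != 0}].
  apply/seteqP; split=> x [Fx xH]; split=> //.
    move=> _ /mapP[[i j] + ->]; rewrite mem_filter /= => /andP[ij _].
    apply/eqP => h0; apply: xH.
    exists [set x | sum0_space x /\ x 0 i - x 0 j = a i]; first by exists i, j.
    by split=> //; apply/eqP; rewrite -subr_eq0; apply/eqP.
  move=> [_ [i [j [ij ->]]] [_ xij]].
  have /eqP : plane (i, j) x != 0.
    by apply: xH; apply: map_f; rewrite mem_filter /= ij mem_enum.
  by apply; rewrite /plane /= xij subrr.
have Laff : {in L, forall h : 'rV[R]_n.+1 -> R, continuous h /\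
     forall x y (t : R), h (x + t *: (y - x)) = h x + t * (h y - h x)}.
  move=> _ /mapP[[i j] _ ->]; split=> [x|x y t]; last by rewrite /plane /= !mxE; ring.
  apply: (continuousB (f := fun y : 'rV[R]_n.+1 => y 0 i - y 0 j) (g := fun=> a i)).
    apply: (continuousB (f := fun y : 'rV[R]_n.+1 => y 0 i) (g := fun y => y 0 j));
      exact: coord_continuous.
  exact: cst_continuous.
have Fconv (x y : 'rV[R]_n.+1) t : F x -> F y -> 0 <= t <= 1 -> F (x + t *: (y - x)).
  rewrite /F /sum0_space /= => Fx Fy _.
  under eq_bigr => i _ do rewrite !mxE.
  by rewrite big_split /= -mulr_sumr sumrB Fx Fy subrr mulr0 addr0.
rewrite (_ : _ @` _ = [set` [fset C in cells F L]%fset]).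
  rewrite set_fsetK card_fseq undup_id //; exact: cells_uniq.
apply/seteqP; split=> C /=.
  move=> [x [Fx xL] <-]; rewrite !inE; apply/mem_cells; exists x; split=> //.
  exact: connected_component_cell.
rewrite !inE => /mem_cells[x [Fx xL ->]]; exists x => //.
exact: connected_component_cell.
Qed.

Lemma nb_regions_cells (b : 'I_n.+2 -> R) : (forall i, b i = a i) ->
  nb_regions_G a n.+1 = ncells_edges b [set~ ord_max]%SET.
Proof.
move=> ba; rewrite regions_card.
pose up (i : 'I_n.+1) : 'I_n.+2 := lift ord_max i.
pose rho (x : 'rV[R]_n.+1) (y : 'I_n.+2 -> R) :=
  exists c, forall i, y (up i) = x 0 i + c.
have planeE x y i j : rho x y -> hyp (up i, up j, b (up i)) y = plane (i, j) x.
  move=> [c yx]; rewrite /hyp /plane /= !yx ba.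
  by rewrite (_ : nat_of_ord (up i) = i) ?lift_max //; ring.
apply: (@ncells_transfer _ _ _ _ _ rho).
- move=> x _; exists (fun k => if unlift ord_max k is Some i then x 0 i else 0) => //.
  by exists 0 => i; rewrite liftK addr0.
- move=> y _; pose m := (\sum_i y (up i)) / n.+1%:R.
  exists (\row_i (y (up i) - m)); last by exists m => i; rewrite mxE subrK.
  rewrite /sum0_space /=; under eq_bigr => i _ do rewrite mxE.
  rewrite sumrB sumr_const card_ord -[m *+ _]mulr_natr /m mulfVK ?subrr //.
move=> x y x' y' xy xy'; split=> s.
  move=> _ /mapP[[[u v] g] + ->]; rewrite mem_edges /= !inE.
  case/and4P => uS vS uv /eqP->.
  case: (unliftP ord_max u) uS uv => [i ->|->] uS uv; last by rewrite eqxx in uS.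
  case: (unliftP ord_max v) vS uv => [j ->|->] vS uv; last by rewrite eqxx in vS.
  rewrite (planeE x) // (planeE x') //; apply: s; apply: map_f.
  by rewrite mem_filter mem_enum /= andbT; apply: contraNneq uv => ->.
move=> _ /mapP[[i j] + ->]; rewrite mem_filter /= => /andP[ij _].
rewrite -(planeE x y) // -(planeE x' y') //; apply: s; apply: map_f.
rewrite mem_edges /= !inE eqxx andbT (inj_eq lift_inj) ij andbT.
by rewrite !(eq_sym _ ord_max) !neq_lift.
Qed.
End RegionsG.

(** * The first coefficients *)

Section FirstCoefficients.
Variable R : realType.

Lemma sum_ord_foldr (F : nat -> R) n :
  \sum_(i < n) F i = foldr (fun i s => F i + s) 0 (iota 0 n).
Proof. by rewrite -(big_mkord xpredT) unlock /index_iota subn0. Qed.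

(* [P k m] is the coefficient of x^m in y^k, abstracted so that simplification
   does not unfold the products of power series. *)
Lemma functional_eq_coefs (P : nat -> nat -> R) :
  (forall k m, P k.+1 m = \sum_(i < m.+1) P 1 i * P k (m - i)%N) ->
  (forall n, P 1 n = (n == 0)%:R +
     \sum_(k < n) (k.+1`!)%:R^-1 * P k.+2 (n - k.+1)%N) ->
  [/\ P 1 0 = 1, P 1 1 = 1, P 1 2 = 5 / 2, P 1 3 = 46 / 6 &
    P 1 4 = 631 / 24 /\ P 1 5 = 11586%:R / 120] /\
  [/\ P 2 0 = 1, P 2 1 = 2, P 2 2 = 6, P 2 3 = 61 / 3 &
    P 2 4 = 445 / 6 /\ P 2 5 = 17041 / 60].
Proof.
move=> powE fixE.
have PS k m : P k.+1 m =
    foldr (fun i s => P 1 i * P k (m - i)%N + s) 0 (iota 0 m.+1).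
  by rewrite powE (sum_ord_foldr (fun i => P 1 i * P k (m - i)%N)).
have P1 n : P 1 n = (n == 0)%:R +
    foldr (fun k s => (k.+1`!)%:R^-1 * P k.+2 (n - k.+1)%N + s) 0 (iota 0 n).
  by rewrite fixE (sum_ord_foldr (fun k => (k.+1`!)%:R^-1 * P k.+2 (n - k.+1)%N)).
have p1_0 : P 1 0 = 1.
  by rewrite P1 /= addr0.
have p2_0 : P 2 0 = 1.
  by rewrite PS /= /subn /= p1_0; clear; lra.
have p3_0 : P 3 0 = 1.
  by rewrite PS /= /subn /= p1_0 p2_0; clear; lra.
have p4_0 : P 4 0 = 1.
  by rewrite PS /= /subn /= p1_0 p3_0; clear; lra.
have p5_0 : P 5 0 = 1.
  by rewrite PS /= /subn /= p1_0 p4_0; clear; lra.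
have p6_0 : P 6 0 = 1.
  by rewrite PS /= /subn /= p1_0 p5_0; clear; lra.
have p1_1 : P 1 1 = 1.
  by rewrite P1 /= /subn /factorial /= p2_0; clear; lra.
have p2_1 : P 2 1 = 2.
  by rewrite PS /= /subn /= p1_0 p1_1; clear; lra.
have p3_1 : P 3 1 = 3.
  by rewrite PS /= /subn /= p1_0 p1_1 p2_0 p2_1; clear; lra.
have p4_1 : P 4 1 = 4.
  by rewrite PS /= /subn /= p1_0 p1_1 p3_0 p3_1; clear; lra.
have p5_1 : P 5 1 = 5.
  by rewrite PS /= /subn /= p1_0 p1_1 p4_0 p4_1; clear; lra.
have p1_2 : P 1 2 = 5 / 2.
  by rewrite P1 /= /subn /factorial /= p2_1 p3_0; clear; lra.
have p2_2 : P 2 2 = 6.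
  by rewrite PS /= /subn /= p1_0 p1_1 p1_2; clear; lra.
have p3_2 : P 3 2 = 21 / 2.
  by rewrite PS /= /subn /= p1_0 p1_1 p1_2 p2_0 p2_1 p2_2; clear; lra.
have p4_2 : P 4 2 = 16.
  by rewrite PS /= /subn /= p1_0 p1_1 p1_2 p3_0 p3_1 p3_2; clear; lra.
have p1_3 : P 1 3 = 46 / 6.
  by rewrite P1 /= /subn /factorial /= p2_2 p3_1 p4_0; clear; lra.
have p2_3 : P 2 3 = 61 / 3.
  by rewrite PS /= /subn /= p1_0 p1_1 p1_2 p1_3; clear; lra.
have p3_3 : P 3 3 = 39.
  by rewrite PS /= /subn /= p1_0 p1_1 p1_2 p1_3 p2_0 p2_1 p2_2 p2_3; clear; lra.
have p1_4 : P 1 4 = 631 / 24.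
  by rewrite P1 /= /subn /factorial /= p2_3 p3_2 p4_1 p5_0; clear; lra.
have p2_4 : P 2 4 = 445 / 6.
  by rewrite PS /= /subn /= p1_0 p1_1 p1_2 p1_3 p1_4; clear; lra.
have p1_5 : P 1 5 = 1931 / 20.
  by rewrite P1 /= /subn /factorial /= p2_4 p3_3 p4_2 p5_1 p6_0; clear; lra.
have p2_5 : P 2 5 = 17041 / 60.
  by rewrite PS /= /subn /= p1_0 p1_1 p1_2 p1_3 p1_4 p1_5; clear; lra.
have -> : 11586%:R / 120 = 1931 / 20 :> R by clear; lra.
by rewrite p1_0 p1_1 p1_2 p1_3 p1_4 p1_5 p2_0 p2_1 p2_2 p2_3 p2_4 p2_5.
Qed.

Lemma log_deriv_coefs (Q z : nat -> R) :
  (forall n, z n.+1 *+ n.+1 = \sum_(i < n.+1) Q i * z (n - i)%N) ->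
  z 0 = 1 ->
  [/\ Q 0 = 1, Q 1 = 2, Q 2 = 6, Q 3 = 61 / 3 &
    Q 4 = 445 / 6 /\ Q 5 = 17041 / 60] ->
  [/\ z 1 = 1, z 2 = 3 / 2, z 3 = 19 / 6 & z 4 = 195 / 24] /\
  (z 5 = 2831 / 120 /\ z 6 = 53703%:R / 720).
Proof.
move=> derivE z0 [q0 q1 q2 q3 [q4 q5]].
have zS n : z n.+1 *+ n.+1 =
    foldr (fun i s => Q i * z (n - i)%N + s) 0 (iota 0 n.+1).
  by rewrite derivE (sum_ord_foldr (fun i => Q i * z (n - i)%N)).
have z1 : z 1 = 1.
  by have := zS 0; rewrite /= /subn /= q0 z0; clear; lra.
have z2 : z 2 = 3 / 2.
  by have := zS 1; rewrite /= /subn /= q0 q1 z0 z1; clear; lra.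
have z3 : z 3 = 19 / 6.
  by have := zS 2; rewrite /= /subn /= q0 q1 q2 z0 z1 z2; clear; lra.
have z4 : z 4 = 195 / 24.
  by have := zS 3; rewrite /= /subn /= q0 q1 q2 q3 z0 z1 z2 z3; clear; lra.
have z5 : z 5 = 2831 / 120.
  by have := zS 4; rewrite /= /subn /= q0 q1 q2 q3 q4 z0 z1 z2 z3 z4; clear; lra.
have z6 : z 6 = 5967 / 80.
  have := zS 5; rewrite /= /subn /=.
  by rewrite q0 q1 q2 q3 q4 q5 z0 z1 z2 z3 z4 z5; clear; lra.
have -> : 53703%:R / 720 = 5967 / 80 :> R by clear; lra.
by [].
Qed.
End FirstCoefficients.

Theorem theorem6p1 (R : realType) (a : nat -> R) (ha : generic a) :
  let z := z_series a in
  egf_begins z [:: 1; 1; 3; 19; 195; 2831; 53703]%N /\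
  exists y : fps R,
    [/\ (forall y' : fps R, 1 = y' * (2 - fps_exp (fpsX * y')) <-> y' = y),
        egf_begins y [:: 1; 1; 5; 46; 631; 11586]%N
      & forall w : fps R,
          (fps_deriv w / w = y ^+ 2 /\ fps_coef w 0 = 1) <-> w = z].
Proof.
move=> z; have [y Hy] := functional_eq_solution R.
have [w Hw] := log_deriv_solution (y ^+ 2).
have yfix := (functional_eq_fixpoint y).1 ((Hy y).2 erefl).
have [wlog w0] := (Hw w).2 erefl; have wE := (log_deriv_eq _ w0).1 wlog.
have zw : z = w.
  apply: fpsP => -[|n]; first by rewrite w0 /= fact0 divr1.
  pose b (i : 'I_n.+2) := a i.
  have b_generic (c : 'I_n.+2 -> int) : (forall i, c i \in [:: -1; 0; 1]) ->
      \sum_i (c i)%:~R * b i = 0 -> forall i, c i = 0 by apply: ha.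
  have cardS : #|[set~ ord_max : 'I_n.+2]%SET| = n.+1.
    by rewrite cardsC1 card_ord.
  have [_ /(_ ord_max)] := cell_count b_generic yfix wE w0 cardS.
  rewrite !inE eqxx => /(_ isT) count; rewrite /z /z_series.
  rewrite [LHS]/= -[LHS]/((nb_regions_G a n.+1)%:R / (n.+1`!)%:R).
  rewrite (@nb_regions_cells _ _ _ b) // count /egf_coef mulrAC divff ?mul1r //.
pose P k m := fps_coef (y ^+ k) m.
have powE k m : P k.+1 m = \sum_(i < m.+1) P 1 i * P k (m - i)%N.
  by rewrite /P exprS fps_coefM expr1.
have fixE n : P 1 n = (n == 0)%:R +
    \sum_(k < n) (k.+1`!)%:R^-1 * P k.+2 (n - k.+1)%N.
  by rewrite /P -fps_coef_fixpoint expr1 yfix.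
have [[y0 y1 y2 y3 [y4 y5]] P2] := functional_eq_coefs powE fixE.
rewrite /P expr1 in y0 y1 y2 y3 y4 y5.
have derivE n : fps_coef w n.+1 *+ n.+1 = \sum_(i < n.+1) P 2 i * fps_coef w (n - i).
  by rewrite -fps_coefM -wE.
have [[w1 w2 w3 w4] [w5 w6]] := log_deriv_coefs derivE w0 P2.
rewrite zw; split.
  case=> [|[|[|[|[|[|[|n]]]]]]] // _; first by rewrite w0 fact0 divr1.
  by rewrite w1 divr1.
exists y; split=> //.
case=> [|[|[|[|[|[|n]]]]]] // _; first by rewrite y0 fact0 divr1.
by rewrite y1 divr1.
Qed.
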